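(* Let $A$ be a regular local ring and let $t_1,\dots,t_n\in A$ be non-zero elements such that $A/t_iA$ is regular for each $i$. Then $K_1(A_{t_1\cdots t_n})=A_{t_1\cdots t_n}^{\times}$, i.e. the determinant map $K_1(A_{t_1\cdots t_n})\to A_{t_1\cdots t_n}^{\times}$ is an isomorphism.
   Context: All rings are commutative, unital and Noetherian. For an element $s$ of a ring $A$, $A_s=A[s^{-1}]$. *)

(* Defs.v *)
From HB Require Import structures.
From mathcomp Require Import all_boot all_algebra.
From mathcomp Require Import ring boolp.

Set Implicit Arguments.
Unset Strict Implicit.
Unset Printing Implicit Defensive.

Import GRing.Theory.
Local Open Scope ring_scope.
Local Open Scope quotient_scope.

(* Rings are [comPzRingType]s, so that the zero ring is allowed: [A / tA] is
   the zero ring when [t] is a unit.  For the same reason the library's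
   [idealr] (proper ideals of a nonzero ring) is not used below. *)

Section Ideals.
Variable R : comPzRingType.
Implicit Types I J P : {pred R}.

Definition ideal I : Prop :=
  0 \in I /\ forall a, {in I &, forall u v, a * u + v \in I}.

Definition prime_ideal P : Prop :=
  [/\ ideal P, 1 \notin P & forall u v, u * v \in P -> (u \in P) || (v \in P)].

Definition maximal_ideal I : Prop :=
  [/\ ideal I, 1 \notin I
    & forall J, ideal J -> 1 \notin J -> {subset I <= J} -> J =i I].

Definition generates d (x : 'I_d -> R) I : Prop :=
  forall y, y \in I <-> exists c : 'I_d -> R, y = \sum_(i < d) c i * x i.

Definition prime_chain d (p : 'I_d.+1 -> {pred R}) : Prop :=
  (forall i, prime_ideal (p i)) /\
  (forall i j : 'I_d.+1, (i < j)%N ->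
     {subset p i <= p j} /\ ~ {subset p j <= p i}).

End Ideals.

Definition noetherian (R : comPzRingType) : Prop :=
  forall I : {pred R}, ideal I -> exists d (x : 'I_d -> R), generates x I.

Definition has_krull_dim (R : comPzRingType) (d : nat) : Prop :=
  (exists p : 'I_d.+1 -> {pred R}, prime_chain p) /\
  (forall e (p : 'I_e.+1 -> {pred R}), prime_chain p -> (e <= d)%N).

Definition local_ring_at (R : comPzRingType) (M : {pred R}) : Prop :=
  maximal_ideal M /\ forall N : {pred R}, maximal_ideal N -> N =i M.

Definition regular_local (R : comPzRingType) : Prop :=
  noetherian R /\
  exists M : {pred R}, local_ring_at M /\
  exists d, has_krull_dim R d /\ exists x : 'I_d -> R, generates x M.

Section Localization.
Variables (R : comPzRingType) (S : mulrClosed R).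

Definition denom := {s : R | s \in S}.
Definition frac_pre := (R * denom)%type.

Definition frac_equiv (x y : frac_pre) : bool :=
  `[< exists2 w, w \in S & w * (x.1 * val y.2) = w * (y.1 * val x.2) >].

Lemma frac_equiv_refl : reflexive frac_equiv.
Proof. by move=> x; apply/asboolP; exists 1; rewrite ?rpred1. Qed.

Lemma frac_equiv_sym : symmetric frac_equiv.
Proof.
by move=> x y; apply/asboolP/asboolP => -[w Sw e]; exists w.
Qed.

Lemma frac_equiv_trans : transitive frac_equiv.
Proof.
move=> [b [u Su]] [a [s Ss]] [c [v Sv]] /asboolP[/= w Sw e] /asboolP[/= z Sz f].
apply/asboolP; exists (w * z * u) => /=; first by rewrite !rpredM.
have -> : w * z * u * (a * v) = w * (a * u) * (z * v) by ring.
have -> : w * z * u * (c * s) = w * s * (z * (c * u)) by ring.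
by rewrite e -f; ring.
Qed.

Canonical frac_equiv_rel :=
  EquivRel frac_equiv frac_equiv_refl frac_equiv_sym frac_equiv_trans.

Definition localization := {eq_quot frac_equiv}.

HB.instance Definition _ : EqQuotient frac_pre frac_equiv localization :=
  EqQuotient.on localization.
HB.instance Definition _ := Choice.on localization.

Lemma denom1_subproof : 1 \in S. Proof. exact: rpred1. Qed.
Lemma denomM_subproof (s u : denom) : val s * val u \in S.
Proof. by rewrite rpredM ?(valP s) ?(valP u). Qed.

Definition denom1 : denom := Sub 1 denom1_subproof.
Definition denomM (s u : denom) : denom :=
  Sub (val s * val u) (denomM_subproof s u).

Definition frac (a : R) (s : denom) : localization := \pi_localization (a, s).

Lemma frac_eqP a s b u :
  frac a s = frac b u <->
  exists2 w, w \in S & w * (a * val u) = w * (b * val s).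
Proof.
split=> [/eqP|h]; first by rewrite /frac piE => /asboolP.
by apply/eqP; rewrite /frac piE; apply/asboolP.
Qed.

Lemma fracW (P : localization -> Prop) :
  (forall a s, P (frac a s)) -> forall x, P x.
Proof. by move=> h x; rewrite -[x]reprK; case: (repr x) => a s; apply: h. Qed.

Definition loc0 : localization := frac 0 denom1.
Definition loc1 : localization := frac 1 denom1.
Definition loc_opp (x : localization) : localization :=
  let (a, s) := repr x in frac (- a) s.
Definition loc_add (x y : localization) : localization :=
  let (a, s) := repr x in let (b, u) := repr y in
  frac (a * val u + b * val s) (denomM s u).
Definition loc_mul (x y : localization) : localization :=
  let (a, s) := repr x in let (b, u) := repr y in
  frac (a * b) (denomM s u).

Lemma loc_oppE a s : loc_opp (frac a s) = frac (- a) s.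
Proof.
rewrite /loc_opp; case def_a': (repr _) => [a' s'].
have /frac_eqP[w Sw e] : frac a' s' = frac a s.
  by rewrite /frac -def_a' reprK.
by apply/frac_eqP; exists w => //; rewrite !mulNr !mulrN e.
Qed.

Lemma loc_addE a s b u :
  loc_add (frac a s) (frac b u) = frac (a * val u + b * val s) (denomM s u).
Proof.
rewrite /loc_add; case def_a': (repr _) => [a' s'].
case def_b': (repr _) => [b' u'].
have /frac_eqP[w Sw e] : frac a' s' = frac a s.
  by rewrite /frac -def_a' reprK.
have /frac_eqP[z Sz f] : frac b' u' = frac b u.
  by rewrite /frac -def_b' reprK.
apply/frac_eqP; exists (w * z); first by rewrite rpredM.
move: e f => /=; set s0 := val s; set u0 := val u.
set s1 := val s'; set u1 := val u' => e f.
transitivity (w * (a' * s0) * (z * u1 * u0) + z * (b' * u0) * (w * s1 * s0)).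
  by ring.
by rewrite e f; ring.
Qed.

Lemma loc_mulE a s b u :
  loc_mul (frac a s) (frac b u) = frac (a * b) (denomM s u).
Proof.
rewrite /loc_mul; case def_a': (repr _) => [a' s'].
case def_b': (repr _) => [b' u'].
have /frac_eqP[w Sw e] : frac a' s' = frac a s.
  by rewrite /frac -def_a' reprK.
have /frac_eqP[z Sz f] : frac b' u' = frac b u.
  by rewrite /frac -def_b' reprK.
apply/frac_eqP; exists (w * z); first by rewrite rpredM.
move: e f => /=; set s0 := val s; set u0 := val u.
set s1 := val s'; set u1 := val u' => e f.
transitivity (w * (a' * s0) * (z * (b' * u0))); first by ring.
by rewrite e f; ring.
Qed.

Let frac_eqI a s b u : a * val u = b * val s -> frac a s = frac b u.
Proof. by move=> e; apply/frac_eqP; exists 1; rewrite ?rpred1 ?e. Qed.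

Lemma loc_addA : associative loc_add.
Proof.
elim/fracW=> a s; elim/fracW=> b u; elim/fracW=> c v.
by rewrite !loc_addE; apply: frac_eqI => /=; ring.
Qed.

Lemma loc_addC : commutative loc_add.
Proof.
elim/fracW=> a s; elim/fracW=> b u.
by rewrite !loc_addE; apply: frac_eqI => /=; ring.
Qed.

Lemma loc_add0 : left_id loc0 loc_add.
Proof.
by elim/fracW=> a s; rewrite !loc_addE; apply: frac_eqI => /=; ring.
Qed.

Lemma loc_addN : left_inverse loc0 loc_opp loc_add.
Proof.
elim/fracW=> a s; rewrite loc_oppE loc_addE.
by apply: frac_eqI => /=; ring.
Qed.

HB.instance Definition _ := GRing.isZmodule.Build localization
  loc_addA loc_addC loc_add0 loc_addN.

Lemma loc_mulA : associative loc_mul.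
Proof.
elim/fracW=> a s; elim/fracW=> b u; elim/fracW=> c v.
by rewrite !loc_mulE; apply: frac_eqI => /=; ring.
Qed.

Lemma loc_mulC : commutative loc_mul.
Proof.
elim/fracW=> a s; elim/fracW=> b u.
by rewrite !loc_mulE; apply: frac_eqI => /=; ring.
Qed.

Lemma loc_mul1 : left_id loc1 loc_mul.
Proof.
by elim/fracW=> a s; rewrite !loc_mulE; apply: frac_eqI => /=; ring.
Qed.

Lemma loc_mulDl : left_distributive loc_mul loc_add.
Proof.
elim/fracW=> a s; elim/fracW=> b u; elim/fracW=> c v.
by rewrite !(loc_mulE, loc_addE); apply: frac_eqI => /=; ring.
Qed.

HB.instance Definition _ := GRing.Zmodule_isComPzRing.Build localization
  loc_mulA loc_mulC loc_mul1 loc_mulDl.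

End Localization.

Section SpecialLocalizations.
Variable R : comPzRingType.

Definition powers (s : R) : {pred R} := fun x => `[< exists k, x = s ^+ k >].

Lemma powers_mulr_closed s : mulr_closed (powers s).
Proof.
split; first by apply/asboolP; exists 0%N.
move=> _ _ /asboolP[k ->] /asboolP[l ->]; apply/asboolP.
by exists (k + l)%N; rewrite exprD.
Qed.

HB.instance Definition _ s :=
  GRing.isMulClosed.Build R (powers s) (powers_mulr_closed s).

Definition loc_away (s : R) : comPzRingType := localization (powers s).

Definition outside (P : {pred R}) : {pred R} := fun x => x \notin P.

Lemma outside_mulr_closed P : prime_ideal P -> mulr_closed (outside P).
Proof.
move=> [_ P1 Pp]; split=> // x y xP yP.
by apply/negP => /Pp; rewrite (negPf xP) (negPf yP).
Qed.

Definition loc_at (P : {pred R}) (Pp : prime_ideal P) : comPzRingType :=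
  let S := HB.pack_for (mulrClosed R) (outside P)
    (GRing.isMulClosed.Build R (outside P) (outside_mulr_closed Pp)) in
  localization S.

End SpecialLocalizations.

Definition regular_ring (R : comPzRingType) : Prop :=
  noetherian R /\
  forall (P : {pred R}) (Pp : prime_ideal P), regular_local (loc_at Pp).

Section PrincipalQuotient.
Variables (R : comPzRingType) (t : R).

Definition multiples : {pred R} := fun x => `[< exists a, x = a * t >].

Lemma multiplesP x : reflect (exists a, x = a * t) (x \in multiples).
Proof. exact: asboolP. Qed.

Lemma multiples_zmod_closed : zmod_closed multiples.
Proof.
split=> [|_ _ /multiplesP[a ->] /multiplesP[b ->]]; apply/multiplesP.
  by exists 0; rewrite mul0r.
by exists (a - b); rewrite mulrBl.
Qed.

HB.instance Definition _ :=
  GRing.isZmodClosed.Build R multiples multiples_zmod_closed.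

Definition quot_by := Quotient.quot multiples.

HB.instance Definition _ := EqQuotient.on quot_by.
HB.instance Definition _ := GRing.Zmodule.on quot_by.

Definition quot_mul (x y : quot_by) : quot_by := \pi_quot_by (repr x * repr y).

Lemma quot_eqP a b :
  \pi_quot_by a = \pi_quot_by b <-> exists c, a - b = c * t.
Proof.
split=> [/eqP|h]; first by rewrite -Quotient.idealrBE => /multiplesP.
by apply/eqP; rewrite -Quotient.idealrBE; apply/multiplesP.
Qed.

Lemma quot_mulE a b :
  quot_mul (\pi_quot_by a) (\pi_quot_by b) = \pi_quot_by (a * b).
Proof.
have /quot_eqP[c ec] := reprK (\pi_quot_by a).
have /quot_eqP[d ed] := reprK (\pi_quot_by b).
apply/quot_eqP; exists (c * repr (\pi_quot_by b) + a * d).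
rewrite mulrDl mulrAC -ec -mulrA -ed.
set x := repr _; set y := repr _; ring.
Qed.

Lemma quot_addE a b :
  \pi_quot_by a + \pi_quot_by b = \pi_quot_by (a + b).
Proof. exact: esym (Quotient.pi_add multiples a b). Qed.

Lemma quot_W (P : quot_by -> Prop) :
  (forall a, P (\pi_quot_by a)) -> forall x, P x.
Proof. by move=> h x; rewrite -[x]reprK. Qed.

Lemma quot_mulA : associative quot_mul.
Proof.
elim/quot_W=> a; elim/quot_W=> b; elim/quot_W=> c.
by rewrite !quot_mulE mulrA.
Qed.

Lemma quot_mulC : commutative quot_mul.
Proof.
by elim/quot_W=> a; elim/quot_W=> b; rewrite !quot_mulE mulrC.
Qed.

Lemma quot_mul1 : left_id (\pi_quot_by 1) quot_mul.
Proof. by elim/quot_W=> a; rewrite quot_mulE mul1r. Qed.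

Lemma quot_mulDl : left_distributive quot_mul +%R.
Proof.
elim/quot_W=> a; elim/quot_W=> b; elim/quot_W=> c.
by rewrite !(quot_mulE, quot_addE) mulrDl.
Qed.

HB.instance Definition _ := GRing.Zmodule_isComPzRing.Build quot_by
  quot_mulA quot_mulC quot_mul1 quot_mulDl.

End PrincipalQuotient.

Section Units.
Variable R : pzRingType.

Definition invertible (x : R) : bool := `[< exists y, y * x = 1 /\ x * y = 1 >].

Record units := Units { unit_val :> R; _ : invertible unit_val }.

HB.instance Definition _ := [isSub for unit_val].
HB.instance Definition _ := [Choice of units by <:].

Lemma invertible1 : invertible 1.
Proof. by apply/asboolP; exists 1; rewrite mulr1. Qed.

Lemma invertibleM (x y : units) : invertible (val x * val y).
Proof.
case: x y => [x /= /asboolP[x' [x'x xx']]] [y /= /asboolP[y' [y'y yy']]].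
apply/asboolP; exists (y' * x'); split.
  by rewrite mulrA -[y' * _ * _]mulrA x'x mulr1.
by rewrite mulrA -[x * _ * _]mulrA yy' mulr1.
Qed.

Definition unit_inv_val (x : units) : R := sval (cid (asboolW (valP x))).

Lemma unit_inv_valP (x : units) :
  unit_inv_val x * val x = 1 /\ val x * unit_inv_val x = 1.
Proof. exact: svalP (cid (asboolW (valP x))). Qed.

Lemma invertibleV (x : units) : invertible (unit_inv_val x).
Proof.
by have [h1 h2] := unit_inv_valP x; apply/asboolP; exists (val x).
Qed.

Definition unit1 : units := Units invertible1.
Definition unitM (x y : units) : units := Units (invertibleM x y).
Definition unitV (x : units) : units := Units (invertibleV x).

Lemma unit_mulA : associative unitM.
Proof. by move=> x y z; apply: val_inj; rewrite /= mulrA. Qed.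
Lemma unit_mul1 : left_id unit1 unitM.
Proof. by move=> x; apply: val_inj; rewrite /= mul1r. Qed.
Lemma unit_mulr1 : right_id unit1 unitM.
Proof. by move=> x; apply: val_inj; rewrite /= mulr1. Qed.
Lemma unit_mulV : left_inverse unit1 unitV unitM.
Proof. by move=> x; apply: val_inj; rewrite /= (unit_inv_valP x).1. Qed.
Lemma unit_mulrV : right_inverse unit1 unitV unitM.
Proof. by move=> x; apply: val_inj; rewrite /= (unit_inv_valP x).2. Qed.

HB.instance Definition _ := isGroup.Build units
  unit_mulA unit_mul1 unit_mulr1 unit_mulV unit_mulrV.

End Units.

Section Abelianization.
Variable G : groupType.
Local Open Scope group_scope.

(* The commutator subgroup [G, G], as the smallest subgroup of [G] containing
   all commutators. *)
Definition derived : {pred G} := fun x =>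
  `[< forall H : {pred G}, group_closed H ->
        (forall a b, [~ a, b] \in H) -> x \in H >].

Lemma derived_group_closed : group_closed derived.
Proof.
split=> [|x y /asboolP xD /asboolP yD]; apply/asboolP => H gH cH.
  exact: gH.1.
by apply: gH.2; [apply: xD | apply: yD].
Qed.

Lemma derivedR a b : [~ a, b] \in derived.
Proof. by apply/asboolP=> H _; apply. Qed.

Lemma derivedJ x z : x \in derived -> x ^ z \in derived.
Proof.
move=> xD; have -> : x ^ z = x * [~ x, z] by rewrite /commg mulgA mulgV mul1g.
exact: group_closedM derived_group_closed _ _ xD (derivedR x z).
Qed.

Definition ab_equiv (x y : G) : bool := x^-1 * y \in derived.

Let dM := group_closedM derived_group_closed.
Let dV := group_closedV derived_group_closed.

Lemma ab_equiv_refl : reflexive ab_equiv.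
Proof. by move=> x; rewrite /ab_equiv mulVg derived_group_closed.1. Qed.

Lemma ab_equiv_sym : symmetric ab_equiv.
Proof.
suff h x y : ab_equiv x y -> ab_equiv y x by move=> x y; apply/idP/idP; apply: h.
by move/dV; rewrite /ab_equiv invgM invgK.
Qed.

Lemma ab_equiv_trans : transitive ab_equiv.
Proof.
move=> y x z xy yz; have := dM xy yz.
by rewrite /ab_equiv mulgA mulgK.
Qed.

Canonical ab_equiv_rel :=
  EquivRel ab_equiv ab_equiv_refl ab_equiv_sym ab_equiv_trans.

Definition abelianization := {eq_quot ab_equiv}.

HB.instance Definition _ : EqQuotient G ab_equiv abelianization :=
  EqQuotient.on abelianization.
HB.instance Definition _ := Choice.on abelianization.

Definition ab_class (x : G) : abelianization := \pi_abelianization x.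

Lemma ab_eqP x y : ab_class x = ab_class y <-> x^-1 * y \in derived.
Proof. by split=> [/eqP|h]; [|apply/eqP]; rewrite /ab_class piE. Qed.

Lemma ab_classK x : ab_class (repr x) = x. Proof. exact: reprK. Qed.

Definition ab1 : abelianization := ab_class 1.
Definition abM (x y : abelianization) := ab_class (repr x * repr y).
Definition abV (x : abelianization) := ab_class (repr x)^-1.

Lemma abME x y : abM (ab_class x) (ab_class y) = ab_class (x * y).
Proof.
have /ab_eqP hx := ab_classK (ab_class x).
have /ab_eqP hy := ab_classK (ab_class y).
apply/ab_eqP; move: hx hy; set x' := repr _; set y' := repr _ => hx hy.
have -> : (x' * y')^-1 * (x * y) = (x'^-1 * x) ^ y' * (y'^-1 * y).
  by rewrite invgM /conjg !mulgA mulgK.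
by apply: dM => //; apply: derivedJ.
Qed.

Lemma abVE x : abV (ab_class x) = ab_class x^-1.
Proof.
have /ab_eqP hx := ab_classK (ab_class x).
apply/ab_eqP; move: hx; set x' := repr _ => hx; rewrite invgK.
have -> : x' * x^-1 = ((x'^-1 * x)^-1) ^ x^-1.
  by rewrite invgM invgK /conjg invgK !mulgA mulgV mul1g.
by apply: derivedJ; apply: dV.
Qed.

Lemma ab_mulA : associative abM.
Proof.
move=> x y z; rewrite -[x]ab_classK -[y]ab_classK -[z]ab_classK.
by rewrite !abME mulgA.
Qed.
Lemma ab_mul1 : left_id ab1 abM.
Proof. by move=> x; rewrite -[x]ab_classK abME mul1g. Qed.
Lemma ab_mulr1 : right_id ab1 abM.
Proof. by move=> x; rewrite -[x]ab_classK abME mulg1. Qed.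
Lemma ab_mulV : left_inverse ab1 abV abM.
Proof. by move=> x; rewrite -[x]ab_classK abVE abME mulVg. Qed.
Lemma ab_mulrV : right_inverse ab1 abV abM.
Proof. by move=> x; rewrite -[x]ab_classK abVE abME mulgV. Qed.

HB.instance Definition _ := isGroup.Build abelianization
  ab_mulA ab_mul1 ab_mulr1 ab_mulV ab_mulrV.

End Abelianization.

Section StableGL.
Variable R : pzRingType.

(* The entries of diag(A, 1, 1, ...). *)
Definition stable_entry n (A : 'M[R]_n) (i j : nat) : R :=
  if (insub i, insub j) is (Some i', Some j') then A i' j' else (i == j)%:R.

(* The stabilization A |-> diag(A, 1, ..., 1) from n x n to N x N matrices.
   It is only meaningful for [n <= N]; leaving this out of the type avoids
   casts between matrix dimensions. *)
Definition pad n N (A : 'M[R]_n) : 'M[R]_N :=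
  \matrix_(i, j) stable_entry A i j.

Lemma pad_block n k (A : 'M[R]_n) : pad (n + k) A = block_mx A 0 0 1%:M.
Proof.
have lt_n (i : 'I_n) : insub (i : nat) = Some i := valK i.
have ge_n (i : 'I_k) : insub (n + i)%N = None :> option 'I_n.
  by rewrite insubF // ltnNge leq_addr.
apply/matrixP=> i j; rewrite mxE /stable_entry.
case: (split_ordP i) => i' ->; case: (split_ordP j) => j' -> /=.
- by rewrite block_mxEul !lt_n.
- rewrite block_mxEur lt_n ge_n mxE.
  by rewrite ltn_eqF // (leq_trans (ltn_ord _)) ?leq_addr.
- rewrite block_mxEdl ge_n mxE.
  by rewrite gtn_eqF // (leq_trans (ltn_ord _)) ?leq_addr.
- by rewrite block_mxEdr ge_n mxE eqn_add2l.
Qed.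

Lemma pad1 n N : (n <= N)%N -> pad N (1%:M : 'M[R]_n) = 1%:M.
Proof. by move/subnKC <-; rewrite pad_block -scalar_mx_block. Qed.

Lemma padM n N (A B : 'M[R]_n) :
  (n <= N)%N -> pad N (A *m B) = pad N A *m pad N B.
Proof.
move/subnKC <-; rewrite !pad_block mulmx_block.
by rewrite !mulmx0 !mul0mx !addr0 !add0r mulmx1.
Qed.

Lemma stable_entry_pad n N (A : 'M[R]_n) i j :
  (n <= N)%N -> stable_entry (pad N A) i j = stable_entry A i j.
Proof.
move=> leN; rewrite {1}/stable_entry.
case: insubP => [i' _ ei|] ; last first.
  rewrite -leqNgt => leNi; rewrite /stable_entry insubF //.
  by rewrite ltnNge (leq_trans leN leNi).
case: insubP => [j' _ ej|]; last first.
  rewrite -leqNgt => leNj; rewrite /stable_entry.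
  rewrite [insub j]insubF; first by case: insubP.
  by rewrite ltnNge (leq_trans leN leNj).
by rewrite mxE ei ej.
Qed.

Lemma pad_pad n N K (A : 'M[R]_n) : (n <= N)%N -> pad K (pad N A) = pad K A.
Proof. by move=> leN; apply/matrixP=> i j; rewrite !mxE stable_entry_pad. Qed.

Lemma pad_id n (A : 'M[R]_n) : pad n A = A.
Proof. by apply/matrixP=> i j; rewrite mxE /stable_entry !valK. Qed.

Lemma pad_eqP n m N (A : 'M[R]_n) (B : 'M[R]_m) : (n <= N)%N -> (m <= N)%N ->
  pad N A = pad N B <-> forall i j, stable_entry A i j = stable_entry B i j.
Proof.
move=> leA leB; split=> [eAB i j|eAB].
  by rewrite -(stable_entry_pad A i j leA) eAB stable_entry_pad.
by apply/matrixP=> i j; rewrite !mxE.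
Qed.

Lemma pad_invertible n N (leN : (n <= N)%N) (A : units 'M[R]_n) :
  invertible (pad N (val A)).
Proof.
case: A => A /= /asboolP[B [BA AB]]; apply/asboolP; exists (pad N B).
have e (C D : 'M[R]_n) : C *m D = 1%:M -> pad N C *m pad N D = 1%:M.
  by move=> CD; rewrite -padM // CD pad1.
by split; apply: e.
Qed.

Definition pad_unit n N (leN : (n <= N)%N) (A : units 'M[R]_n) :
  units 'M[R]_N := Units (pad_invertible leN A).

(* GL(R) is the colimit of the groups GL_n(R) = [units 'M[R]_n] along
   stabilization. *)
Definition GL_pre := {n : nat & units 'M[R]_n}.

Definition GL_equiv (x y : GL_pre) : bool :=
  let N := maxn (tag x) (tag y) in
  pad N (val (tagged x)) == pad N (val (tagged y)).

Lemma GL_equivP (x y : GL_pre) :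
  reflect (forall i j, stable_entry (val (tagged x)) i j
                       = stable_entry (val (tagged y)) i j)
          (GL_equiv x y).
Proof.
have le1 := leq_maxl (tag x) (tag y); have le2 := leq_maxr (tag x) (tag y).
by apply: (iffP eqP) => /(pad_eqP _ _ le1 le2).
Qed.

Lemma GL_equiv_refl : reflexive GL_equiv.
Proof. by move=> x; apply/GL_equivP. Qed.

Lemma GL_equiv_sym : symmetric GL_equiv.
Proof. by move=> x y; apply/GL_equivP/GL_equivP => h i j; rewrite h. Qed.

Lemma GL_equiv_trans : transitive GL_equiv.
Proof.
by move=> y x z /GL_equivP h /GL_equivP k; apply/GL_equivP=> i j; rewrite h.
Qed.

Canonical GL_equiv_rel :=
  EquivRel GL_equiv GL_equiv_refl GL_equiv_sym GL_equiv_trans.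

Definition GL := {eq_quot GL_equiv}.

HB.instance Definition _ : EqQuotient GL_pre GL_equiv GL := EqQuotient.on GL.
HB.instance Definition _ := Choice.on GL.

Definition GL_class n (A : units 'M[R]_n) : GL :=
  \pi_GL (Tagged (fun n => units 'M[R]_n) A).

Lemma GL_eqP n m N (A : units 'M[R]_n) (B : units 'M[R]_m) :
  (n <= N)%N -> (m <= N)%N ->
  GL_class A = GL_class B <-> pad N (val A) = pad N (val B).
Proof.
move=> leA leB; rewrite (pad_eqP _ _ leA leB) /GL_class.
split=> [/eqP|h]; first by rewrite piE => /GL_equivP.
by apply/eqP; rewrite piE; apply/GL_equivP.
Qed.

Lemma GL_W (P : GL -> Prop) :
  (forall n (A : units 'M[R]_n), P (GL_class A)) -> forall x, P x.
Proof. by move=> h x; rewrite -[x]reprK; case: (repr x) => n A; apply: h. Qed.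

Lemma GL_class_pad n N (leN : (n <= N)%N) (A : units 'M[R]_n) :
  GL_class (pad_unit leN A) = GL_class A.
Proof. by apply/(@GL_eqP _ _ N) => //=; rewrite pad_id. Qed.

Definition GL_one : GL := GL_class (1%g : units 'M[R]_0).

Definition GL_mul (x y : GL) : GL :=
  let (n, A) := repr x in let (m, B) := repr y in
  GL_class (pad_unit (leq_maxl n m) A * pad_unit (leq_maxr n m) B)%g.

Definition GL_inv (x : GL) : GL := let (n, A) := repr x in GL_class A^-1%g.

Lemma GL_mulE n m N (leA : (n <= N)%N) (leB : (m <= N)%N)
    (A : units 'M[R]_n) (B : units 'M[R]_m) :
  GL_mul (GL_class A) (GL_class B)
  = GL_class (pad_unit leA A * pad_unit leB B)%g.
Proof.
rewrite /GL_mul; case def_A: (repr _) => [n' A']; case def_B: (repr _) => [m' B'].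
have eA : GL_class A' = GL_class A by rewrite -[RHS]reprK def_A.
have eB : GL_class B' = GL_class B by rewrite -[RHS]reprK def_B.
set N' := maxn n' m'; set K := maxn N N'.
have leN : (N <= K)%N := leq_maxl _ _; have leN' : (N' <= K)%N := leq_maxr _ _.
have leA' := leq_maxl n' m'; have leB' := leq_maxr n' m'.
apply/(GL_eqP _ _ leN' leN) => /=.
change (pad K (pad N' (val A') *m pad N' (val B'))
        = pad K (pad N (val A) *m pad N (val B))).
rewrite !padM // !pad_pad //.
have /(GL_eqP _ _ (leq_trans leA' leN') (leq_trans leA leN)) -> := eA.
by have /(GL_eqP _ _ (leq_trans leB' leN') (leq_trans leB leN)) -> := eB.
Qed.

Lemma GL_mul_class n (A B : units 'M[R]_n) :
  GL_mul (GL_class A) (GL_class B) = GL_class (A * B)%g.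
Proof.
rewrite (GL_mulE (leqnn n) (leqnn n)); congr GL_class.
by apply: val_inj => /=; rewrite !pad_id.
Qed.

Lemma GL_invE n (A : units 'M[R]_n) : GL_inv (GL_class A) = GL_class A^-1%g.
Proof.
rewrite /GL_inv; case def_A: (repr _) => [n' A'].
have eA : GL_class A' = GL_class A by rewrite -[RHS]reprK def_A.
have leA := leq_maxl n n'; have leA' := leq_maxr n n'.
rewrite -(GL_class_pad leA' A'^-1%g) -(GL_class_pad leA A^-1%g).
have padV m (leN : (m <= maxn n n')%N) (B : units 'M[R]_m) :
    pad_unit leN B^-1%g = ((pad_unit leN B)^-1)%g.
  rewrite -[LHS]mulg1 -(mulgV (pad_unit leN B)) mulgA.
  suff -> : (pad_unit leN B^-1 * pad_unit leN B = 1)%g by rewrite mul1g.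
  apply: val_inj; change (pad (maxn n n') (val B^-1%g) *m
    pad (maxn n n') (val B) = 1%:M).
  have e : val B^-1%g *m val B = 1%:M := congr1 val (mulVg B).
  by rewrite -padM // e pad1.
rewrite !padV; congr (GL_class _^-1)%g; apply: val_inj => /=.
exact/(GL_eqP _ _ leA' leA).
Qed.

Lemma GL_oneE n : GL_one = GL_class (1%g : units 'M[R]_n).
Proof.
apply/(GL_eqP _ _ (leq0n n) (leqnn n)).
change (pad n (1%:M : 'M[R]_0) = pad n (1%:M : 'M[R]_n)).
by rewrite !pad1.
Qed.

Lemma GL_mulA : associative GL_mul.
Proof.
elim/GL_W=> n A; elim/GL_W=> m B; elim/GL_W=> k C.
pose N := (n + m + k)%N.
have leA : (n <= N)%N by rewrite /N -addnA leq_addr.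
have leB : (m <= N)%N by rewrite /N addnAC leq_addl.
have leC : (k <= N)%N by rewrite leq_addl.
rewrite -(GL_class_pad leA A) -(GL_class_pad leB B) -(GL_class_pad leC C).
by rewrite !GL_mul_class mulgA.
Qed.

Lemma GL_mul1 : left_id GL_one GL_mul.
Proof. by elim/GL_W=> n A; rewrite (GL_oneE n) GL_mul_class mul1g. Qed.

Lemma GL_mulr1 : right_id GL_one GL_mul.
Proof. by elim/GL_W=> n A; rewrite (GL_oneE n) GL_mul_class mulg1. Qed.

Lemma GL_mulV : left_inverse GL_one GL_inv GL_mul.
Proof.
by elim/GL_W=> n A; rewrite (GL_oneE n) GL_invE GL_mul_class mulVg.
Qed.

Lemma GL_mulrV : right_inverse GL_one GL_inv GL_mul.
Proof.
by elim/GL_W=> n A; rewrite (GL_oneE n) GL_invE GL_mul_class mulgV.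
Qed.

HB.instance Definition _ := isGroup.Build GL
  GL_mulA GL_mul1 GL_mulr1 GL_mulV GL_mulrV.

End StableGL.

Definition K1 (R : pzRingType) : groupType := abelianization (GL R).

Section Determinant.
Variable R : comPzRingType.

Lemma det_invertible n (A : units 'M[R]_n) : invertible (\det (val A)).
Proof.
case: A => A /= /asboolP[B [BA AB]]; apply/asboolP; exists (\det B).
have e (C D : 'M[R]_n) : C *m D = 1%:M -> \det C * \det D = 1.
  by rewrite -det_mulmx => ->; rewrite det1.
by split; apply: e.
Qed.

Definition det_unit n (A : units 'M[R]_n) : units R :=
  Units (det_invertible A).

Definition det_GL (x : GL R) : units R := det_unit (tagged (repr x)).

Definition det_K1 (x : K1 R) : units R := det_GL (repr x).

Lemma det_pad n N (A : 'M[R]_n) : (n <= N)%N -> \det (pad N A) = \det A.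
Proof. by move/subnKC <-; rewrite pad_block det_ublock det1 mulr1. Qed.

Lemma det_GLE n (A : units 'M[R]_n) : det_GL (GL_class A) = det_unit A.
Proof.
rewrite /det_GL; case def_A: (repr _) => [n' A'].
have eA : GL_class A' = GL_class A by rewrite -[RHS]reprK def_A.
have leA := leq_maxl n n'; have leA' := leq_maxr n n'.
apply: val_inj => /=; rewrite -(det_pad (val A') leA') -(det_pad (val A) leA).
by have /(GL_eqP _ _ leA' leA) -> := eA.
Qed.

Lemma det_GLM : {morph det_GL : x y / (x * y)%g}.
Proof.
elim/GL_W=> n A; elim/GL_W=> m B.
have leA := leq_maxl n m; have leB := leq_maxr n m.
rewrite -(GL_class_pad leA A) -(GL_class_pad leB B).
rewrite [(_ * _)%g]GL_mul_class !det_GLE; apply: val_inj; exact: det_mulmx.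
Qed.

HB.instance Definition _ :=
  isMultiplicative.Build (GL R) (units R) det_GL det_GLM.

Lemma unit_mulC (x y : units R) : (x * y = y * x)%g.
Proof. by apply: val_inj; rewrite /= mulrC. Qed.

Lemma det_K1E (x : GL R) : det_K1 (ab_class x) = det_GL x.
Proof.
have dGL1 : det_GL 1%g = 1%g.
  by apply: (mulgI (det_GL 1%g)); rewrite -det_GLM !mulg1.
have dGLV y : det_GL y^-1%g = (det_GL y)^-1%g.
  by apply: (mulgI (det_GL y)); rewrite -det_GLM !mulgV.
have ker y : y \in @derived (GL R) -> det_GL y = 1%g.
  move/asboolP=> /(_ [pred z | det_GL z == 1%g])/= h; apply/eqP/h.
    split; first by rewrite inE dGL1.
    move=> a b; rewrite !inE => /eqP da /eqP db.
    by rewrite det_GLM dGLV da db mulgV.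
  move=> a b; rewrite inE /commg /conjg !det_GLM !dGLV.
  by rewrite (unit_mulC (det_GL a)) mulKg mulVg.
have /ab_eqP/ker := ab_classK (ab_class x).
rewrite det_GLM dGLV => e; rewrite /det_K1.
by apply/esym; rewrite -[LHS](mulVKg (det_GL (repr (ab_class x)))) e mulg1.
Qed.

Lemma det_K1M : {morph det_K1 : x y / (x * y)%g}.
Proof.
move=> x y; rewrite -[x]ab_classK -[y]ab_classK.
by rewrite [(_ * _)%g]abME !det_K1E det_GLM.
Qed.

HB.instance Definition _ :=
  isMultiplicative.Build (K1 R) (units R) det_K1 det_K1M.

End Determinant.

Definition group_isomorphism (G H : groupType) (f : G -> H) : Prop :=
  {morph f : x y / (x * y)%g} /\ bijective f.

(* Main.v *)
From HB Require Import structures.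
Require Import Defs.
From mathcomp Require Import all_boot all_algebra.
From mathcomp Require Import ring boolp.

(** Every class of K_1(C), C = A[1/(t_1 ... t_n)], is the class of a 1 x 1
    matrix, so the determinant is inverse to the evident map from units to
    K_1(C) ([det_K1_iso]).

    For the local ring A itself this is row elimination ([local_unit_class]).
    The t_i are then inverted one at a time.  Write B for A with some of them
    inverted, realized as a subring of C, and s for the next one.  Exactness of
      K_1(B) -> K_1(B[1/s]) -> K_0(B/s)
    together with the fact that K_0(B/s) is generated by the class of B/s says
    that K_1(B[1/s]) is generated by K_1(B) and the class of s; this is what
    [unit_class_away] proves.  A matrix M over B, invertible over
    B[1/s], is seen as the lattice B^n M.  The class of M modulo units and
    K_1(B) is an additive invariant of the s-torsion module B^n / B^n M,
    computed by resolving it.  Only the vanishing of this invariant is needed,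
    and that is defined directly: a lattice is null ([null_lattice]) when
    finitely many passages to syzygies turn it into a free lattice whose basis
    has the class of a unit.  Three facts carry the argument.
    - A free null lattice has a basis with the class of a unit
      ([null_unit_class]): by Schanuel, the syzygies of a free lattice are
      stably free, with a basis of explicitly computable class.
    - Null lattices are stable under extensions ([null_extension], the
      horseshoe lemma).
    - A module killed by s gives a null lattice as soon as it has a finite free
      resolution over B/s ([null_mod_span]), for then all its syzygies end in
      s B^m, whose basis s has the class of a unit.
    Filtering B^n / B^n M by the powers of s reduces the general case to modules
    killed by s ([devissage]).

    The remaining input is that finitely generated modules over A/t, with t one
    of the t_i, have finite free resolutions, a property which localizes
    ([finite_res_away]).  If the maximal ideal of a regular local ring of
    dimension d is generated by x_1, ..., x_d, Krull's principal ideal theorem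
    ([intermediate_prime]) pushes a chain of primes of length d into one whose
    second term contains x_1 ([chain_shift]).  So the quotient by x_1 is of the
    same kind with d - 1 generators; inductively x_1 generates a prime ideal,
    Nakayama's lemma makes the ring a domain, and resolutions modulo x_1 lift
    because x_1 is regular on syzygies ([finite_res_lift]).  The same induction
    shows that A is a domain, which makes A a subring of C. *)

Set Implicit Arguments.
Unset Strict Implicit.
Unset Printing Implicit Defensive.

Import GRing.Theory.
Local Open Scope ring_scope.
Local Open Scope quotient_scope.

(** * Classes of matrices in K_1 *)

Lemma abelianization_mulC (G : groupType) (x y : abelianization G) :
  (x * y = y * x)%g.
Proof.
rewrite -[x]ab_classK -[y]ab_classK; move: (repr x) (repr y) => a b.
rewrite [LHS]abME [RHS]abME; apply/ab_eqP.
suff -> : ((a * b)^-1 * (b * a) = [~ b, a])%g by apply: derivedR.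
by rewrite /commg /conjg invgM -mulgA.
Qed.

Section K1Classes.
Variable C : comPzRingType.

Definition K1_class n (U : units 'M[C]_n) : K1 C := ab_class (GL_class U).

Lemma K1_classM n (U V : units 'M[C]_n) : K1_class (U * V)%g =
  (K1_class U * K1_class V)%g.
Proof. by rewrite /K1_class [RHS]abME -GL_mul_class. Qed.

Lemma K1_class1 n : K1_class (1%g : units 'M[C]_n) = 1%g.
Proof.
by apply: (mulgI (K1_class (1%g : units 'M[C]_n))); rewrite -K1_classM !mulg1.
Qed.

Lemma K1_classV n (U : units 'M[C]_n) : K1_class U^-1%g = (K1_class U)^-1%g.
Proof. by apply: (mulgI (K1_class U)); rewrite -K1_classM !mulgV K1_class1. Qed.

Lemma invertible_mxP n (M : 'M[C]_n) :
  reflect (exists N, N *m M = 1%:M /\ M *m N = 1%:M) (invertible M).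
Proof. exact: asboolP. Qed.

(** The sizes are equal only up to a proof: this is used to exchange the two
    blocks of a matrix of size n + k. *)
Lemma K1_class_conj n m (U : units 'M[C]_n) (V : units 'M[C]_m)
    (P : 'M[C]_(m, n)) (Q : 'M[C]_(n, m)) :
  m = n -> P *m Q = 1%:M -> val V = P *m val U *m Q -> K1_class V = K1_class U.
Proof.
move=> e; subst m => PQ eV; have QP := mulmx1C PQ.
have iP : invertible P by apply/invertible_mxP; exists Q.
have iQ : invertible Q by apply/invertible_mxP; exists P.
have -> : V = (Units iP * U * Units iQ)%g by apply: val_inj.
rewrite !K1_classM abelianization_mulC mulgA -K1_classM.
have -> : (Units iQ * Units iP)%g = 1%g by apply: val_inj.
by rewrite K1_class1 mul1g.
Qed.

Lemma K1_class_pad n k (U : units 'M[C]_n) (V : units 'M[C]_(n + k)) :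
  val V = block_mx (val U) 0 0 1%:M -> K1_class V = K1_class U.
Proof.
rewrite -pad_block => eV; rewrite /K1_class -(GL_class_pad (leq_addr k n) U).
by congr (ab_class (GL_class _)); apply: val_inj.
Qed.

Lemma K1_class_pad_dr n k (U : units 'M[C]_n) (V : units 'M[C]_(k + n)) :
  val V = block_mx 1%:M 0 0 (val U) -> K1_class V = K1_class U.
Proof.
move=> eV; have ipad := pad_invertible (leq_addr k n) U.
rewrite -(@K1_class_pad n k U (Units ipad)); last by rewrite /= pad_block.
apply: (K1_class_conj (P := block_mx 0 1%:M 1%:M 0) (Q :=
  block_mx 0 1%:M 1%:M 0)).
- exact: addnC.
- rewrite mulmx_block !mulmx0 !mul0mx !mulmx1 !add0r !addr0.
  by rewrite -scalar_mx_block.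
- rewrite /= pad_block eV !mulmx_block !mulmx0 !mul0mx !mulmx1 !mul1mx.
  by rewrite !add0r !addr0.
Qed.

(** When y e = 0, the stabilization of 1 + e y is the commutator of the
    unipotent block matrices with off-diagonal blocks e and y.  Every elementary
    matrix has the form 1 + e y, so this contains the triviality of elementary
    matrices in K_1. *)
Lemma K1_class_unipotent p q
  (U : units 'M[C]_p) (e : 'M[C]_(p, q)) (y : 'M[C]_(q, p)) :
  y *m e = 0 -> val U = 1%:M + e *m y -> K1_class U = 1%g.
Proof.
move=> ye0 eU.
pose a : 'M[C]_(p + q) := block_mx 1%:M e 0 1%:M.
pose b : 'M[C]_(p + q) := block_mx 1%:M 0 y 1%:M.
have ia : invertible a.
  apply/invertible_mxP; exists (block_mx 1%:M (- e) 0 1%:M).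
  rewrite !mulmx_block !mulmx0 !mul0mx !mulmx1 !mul1mx !addr0 !add0r.
  by rewrite addNr addrN -scalar_mx_block.
have ib : invertible b.
  apply/invertible_mxP; exists (block_mx 1%:M 0 (- y) 1%:M).
  rewrite !mulmx_block !mulmx0 !mul0mx !mulmx1 !mul1mx !addr0 !add0r.
  by rewrite addNr addrN -scalar_mx_block.
have ipad := pad_invertible (leq_addr q p) U.
rewrite -(@K1_class_pad p q U (Units ipad)); last by rewrite /= pad_block.
have eab : block_mx (1%:M + e *m y) 0 0 1%:M *m (b *m a) = a *m b.
  rewrite !mulmx_block !mulmx0 !mul0mx !mulmx1 !mul1mx !addr0 !add0r.
  by rewrite ye0 add0r mulmx1 mulmxDl mul1mx -mulmxA ye0 mulmx0 addr0.
have eUba : (Units ipad * (Units ib * Units ia))%g = (Units ia * Units ib)%g.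
  apply: val_inj; change (pad (p + q) (val U) *m (b *m a) = a *m b).
  by rewrite pad_block eU; apply: eab.
apply: (mulIg (K1_class (Units ib) * K1_class (Units ia))%g).
by rewrite mul1g -!K1_classM eUba K1_classM abelianization_mulC -K1_classM.
Qed.


Lemma K1_class_diag n m (U : units 'M[C]_n) (V : units 'M[C]_m)
    (W : units 'M[C]_(n + m)) :
  val W = block_mx (val U) 0 0 (val V) -> K1_class W =
    (K1_class U * K1_class V)%g.
Proof.
move=> eW.
have [/= U' [U'U UU']] := invertible_mxP _ (valP U).
have [/= V' [V'V VV']] := invertible_mxP _ (valP V).
have iU : invertible (block_mx (val U) 0 0 1%:M : 'M[C]_(n + m)).
  apply/invertible_mxP; exists (block_mx U' 0 0 1%:M).
  rewrite !mulmx_block !mulmx0 !mul0mx !mulmx1 !addr0 !add0r U'U UU'.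
  by rewrite -scalar_mx_block.
have iV : invertible (block_mx 1%:M 0 0 (val V) : 'M[C]_(n + m)).
  apply/invertible_mxP; exists (block_mx 1%:M 0 0 V').
  rewrite !mulmx_block !mulmx0 !mul0mx !mulmx1 !addr0 !add0r V'V VV'.
  by rewrite -scalar_mx_block.
rewrite -(@K1_class_pad n m U (Units iU)) // -(@K1_class_pad_dr m n V
  (Units iV)) // -K1_classM.
congr K1_class; apply: val_inj; rewrite eW.
suff : block_mx (val U) 0 0 (val V) = block_mx (val U) 0 0 1%:M *m
  block_mx 1%:M 0 0 (val V) :> 'M[C]_(n + m) by [].
by rewrite mulmx_block !mulmx0 !mul0mx !mulmx1 !mul1mx !addr0 !add0r.
Qed.

Lemma K1_class_lower n m (U : units 'M[C]_n) (V : units 'M[C]_m) (X :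
  'M[C]_(m, n))
    (W : units 'M[C]_(n + m)) :
  val W = block_mx (val U) 0 X (val V) -> K1_class W =
    (K1_class U * K1_class V)%g.
Proof.
move=> eW.
have [/= U' [U'U UU']] := invertible_mxP _ (valP U).
have [/= V' [V'V VV']] := invertible_mxP _ (valP V).
have iD : invertible (block_mx (val U) 0 0 (val V) : 'M[C]_(n + m)).
  apply/invertible_mxP; exists (block_mx U' 0 0 V').
  rewrite !mulmx_block !mulmx0 !mul0mx !addr0 !add0r V'V VV' U'U UU'.
  by rewrite -scalar_mx_block.
pose E (Y : 'M[C]_(m, n)) : 'M[C]_(n + m) := block_mx 1%:M 0 Y 1%:M.
have iE : invertible (E (V' *m X)).
  apply/invertible_mxP; exists (E (- (V' *m X))).
  rewrite !mulmx_block !mulmx0 !mul0mx !mulmx1 !mul1mx !addr0 !add0r.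
  by rewrite addNr addrN -scalar_mx_block.
rewrite -(@K1_class_diag n m U V (Units iD)) //.
have e1 : K1_class (Units iE) = 1%g.
  apply: (K1_class_unipotent (e := col_mx 0 1%:M) (y := row_mx (V' *m X) 0)).
    by rewrite mul_row_col mulmx0 mul0mx addr0.
  rewrite mul_col_row !mul0mx !mul1mx scalar_mx_block add_block_mx.
  by rewrite !addr0 add0r.
rewrite -[RHS]mulg1 -e1 -K1_classM; congr K1_class; apply: val_inj; rewrite eW.
suff : block_mx (val U) 0 X (val V) =
  block_mx (val U) 0 0 (val V) *m E (V' *m X) by [].
rewrite mulmx_block !mulmx0 !mul0mx !mulmx1 !addr0 !add0r.
by rewrite mulmxA VV' mul1mx.
Qed.

Lemma K1_class_upper n m (U : units 'M[C]_n) (V : units 'M[C]_m) (X :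
  'M[C]_(n, m))
    (W : units 'M[C]_(n + m)) :
  val W = block_mx (val U) X 0 (val V) -> K1_class W =
    (K1_class U * K1_class V)%g.
Proof.
move=> eW.
have [/= U' [U'U UU']] := invertible_mxP _ (valP U).
have [/= V' [V'V VV']] := invertible_mxP _ (valP V).
have iD : invertible (block_mx (val U) 0 0 (val V) : 'M[C]_(n + m)).
  apply/invertible_mxP; exists (block_mx U' 0 0 V').
  rewrite !mulmx_block !mulmx0 !mul0mx !addr0 !add0r V'V VV' U'U UU'.
  by rewrite -scalar_mx_block.
pose E (Y : 'M[C]_(n, m)) : 'M[C]_(n + m) := block_mx 1%:M Y 0 1%:M.
have iE : invertible (E (U' *m X)).
  apply/invertible_mxP; exists (E (- (U' *m X))).
  rewrite !mulmx_block !mulmx0 !mul0mx !mulmx1 !mul1mx !addr0 !add0r.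
  by rewrite addNr addrN -scalar_mx_block.
rewrite -(@K1_class_diag n m U V (Units iD)) //.
have e1 : K1_class (Units iE) = 1%g.
  apply: (K1_class_unipotent (e := col_mx (U' *m X) 0) (y := row_mx 0 1%:M)).
    by rewrite mul_row_col mulmx0 mul0mx addr0.
  rewrite mul_col_row !mul0mx !mulmx0 !mulmx1 scalar_mx_block add_block_mx.
  by rewrite !addr0 add0r.
rewrite -[RHS]mulg1 -e1 -K1_classM; congr K1_class; apply: val_inj; rewrite eW.
suff : block_mx (val U) X 0 (val V) =
  block_mx (val U) 0 0 (val V) *m E (U' *m X) by [].
rewrite mulmx_block !mulmx0 !mul0mx !mulmx1 !addr0 !add0r.
by rewrite mulmxA UU' mul1mx.
Qed.

Definition rank1_class (x : K1 C) := exists V : units 'M[C]_1, x = K1_class V.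

(** The predicate to be established for every invertible matrix. *)
Definition unit_class n (M : 'M[C]_n) :=
  exists2 U : units 'M[C]_n, val U = M & rank1_class (K1_class U).

Lemma rank1_classM x y :
  rank1_class x -> rank1_class y -> rank1_class (x * y)%g.
Proof. by move=> [U ->] [V ->]; exists (U * V)%g; rewrite K1_classM. Qed.

Lemma rank1_classV x : rank1_class x -> rank1_class x^-1%g.
Proof. by move=> [U ->]; exists U^-1%g; rewrite K1_classV. Qed.

Lemma unit_class_invertible n (M : 'M[C]_n) : unit_class M -> invertible M.
Proof. by case=> U <- _; apply: valP. Qed.

Lemma unit_class1 n : unit_class (1%:M : 'M[C]_n).
Proof. by exists 1%g => //; exists 1%g; rewrite !K1_class1. Qed.

Lemma unit_class_rank1 (M : 'M[C]_1) : invertible M -> unit_class M.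
Proof. by move=> iM; exists (Units iM) => //; exists (Units iM). Qed.

Lemma unit_classM n (M N : 'M[C]_n) :
  unit_class M -> unit_class N -> unit_class (M *m N).
Proof.
move=> [U <- rU] [V <- rV]; exists (U * V)%g => //.
by rewrite K1_classM; apply: rank1_classM.
Qed.

Lemma unit_class_divl n (M N : 'M[C]_n) :
  unit_class M -> unit_class (M *m N) -> unit_class N.
Proof.
move=> [U <- rU] [V eV rV]; exists (U^-1 * V)%g; last first.
  by rewrite K1_classM K1_classV; apply: rank1_classM => //;
    apply: rank1_classV.
have e : val U^-1%g *m val U = 1%:M := congr1 val (mulVg U).
suff : val U^-1%g *m val V = N by [].
by rewrite eV mulmxA e mul1mx.
Qed.

Lemma unit_class_divr n (M N : 'M[C]_n) :
  unit_class N -> unit_class (M *m N) -> unit_class M.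
Proof.
move=> [U <- rU] [V eV rV]; exists (V * U^-1)%g; last first.
  by rewrite K1_classM K1_classV; apply: rank1_classM => //;
    apply: rank1_classV.
have e : val U *m val U^-1%g = 1%:M := congr1 val (mulgV U).
suff : val V *m val U^-1%g = M by [].
by rewrite eV -mulmxA e mulmx1.
Qed.

Lemma unit_class_lower n m (M : 'M[C]_n) (N : 'M[C]_m) X :
  unit_class M -> unit_class N -> unit_class (block_mx M 0 X N).
Proof.
move=> [U <- rU] [V <- rV].
have [/= U' [U'U UU']] := invertible_mxP _ (valP U).
have [/= V' [V'V VV']] := invertible_mxP _ (valP V).
have iW : invertible (block_mx (val U) 0 X (val V)).
  suff h : block_mx (val U) 0 X (val V) *m
      block_mx U' 0 (- (V' *m X *m U')) V' = 1%:M.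
    by apply/invertible_mxP; eexists; split; last exact: h; apply: mulmx1C.
  rewrite mulmx_block !mulmx0 !mul0mx !addr0 !add0r UU' VV' mulmxN.
  by rewrite !mulmxA VV' mul1mx addrN -scalar_mx_block.
exists (Units iW) => //.
by rewrite (@K1_class_lower _ _ U V X) //; apply: rank1_classM.
Qed.

Lemma unit_class_upper n m (M : 'M[C]_n) (N : 'M[C]_m) X :
  unit_class M -> unit_class N -> unit_class (block_mx M X 0 N).
Proof.
move=> [U <- rU] [V <- rV].
have [/= U' [U'U UU']] := invertible_mxP _ (valP U).
have [/= V' [V'V VV']] := invertible_mxP _ (valP V).
have iW : invertible (block_mx (val U) X 0 (val V)).
  suff h : block_mx (val U) X 0 (val V) *m
      block_mx U' (- (U' *m X *m V')) 0 V' = 1%:M.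
    by apply/invertible_mxP; eexists; split; last exact: h; apply: mulmx1C.
  rewrite mulmx_block !mulmx0 !mul0mx !addr0 !add0r UU' VV' mulmxN.
  by rewrite !mulmxA UU' mul1mx addNr -scalar_mx_block.
exists (Units iW) => //.
by rewrite (@K1_class_upper _ _ U V X) //; apply: rank1_classM.
Qed.

Lemma unit_class_upper_dr n m (N : 'M[C]_m) (X : 'M[C]_(n, m)) :
  invertible N -> unit_class (block_mx 1%:M X 0 N) -> unit_class N.
Proof.
move=> iN [W eW rW]; exists (Units iN) => //.
by move: rW; rewrite (@K1_class_upper _ _ 1%g (Units iN) X) // K1_class1 mul1g.
Qed.

Lemma unit_class_scalar n (s : C) :
  invertible s -> unit_class (s%:M : 'M[C]_n).
Proof.
move=> /asboolP[s' [s's ss']]; elim: n => [|n IHn].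
  have -> : s%:M = 1%:M :> 'M[C]_0 by apply/matrixP; case.
  exact: unit_class1.
rewrite -[n.+1]/(1 + n)%N scalar_mx_block; apply: unit_class_lower => //.
apply: unit_class_rank1; apply/invertible_mxP; exists s'%:M.
by rewrite -!scalar_mxM s's ss'.
Qed.

End K1Classes.

(** * Elimination over a local ring *)

Section LocalElimination.
Variables (A C : comPzRingType) (iota : {rmorphism A -> C}).
Hypothesis local_add :
  forall a b : A, invertible (a + b) -> invertible a \/ invertible b.

Lemma unit_class_pivot n (a : 'M[A]_1) (b : 'M[A]_(1, n)) c d :
  (forall M : 'M[A]_n, invertible M -> unit_class (map_mx iota M)) ->
  invertible a -> invertible (block_mx a b c d) ->
  unit_class (map_mx iota (block_mx a b c d)).
Proof.
move=> IHn ia iM; have [a' [a'a aa']] := invertible_mxP _ ia.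
pose d' := d - c *m a' *m b.
have eM : block_mx a b c d = block_mx 1%:M 0 (c *m a') 1%:M *m
    block_mx a b 0 d'.
  rewrite mulmx_block !mul1mx !mul0mx !addr0 -mulmxA a'a mulmx1.
  by rewrite /d' addrC subrK.
have id' : invertible d'.
  have [N [NM _]] := invertible_mxP _ iM.
  move: NM; rewrite eM mulmxA; set N' := N *m _.
  rewrite -[N']submxK mulmx_block !mulmx0 !addr0.
  rewrite [1%:M]scalar_mx_block => /eq_block_mx[_ _ e0 e1].
  have z : dlsubmx N' = 0 by rewrite -[LHS]mulmx1 -aa' mulmxA e0 mul0mx.
  rewrite z mul0mx add0r in e1.
  by apply/invertible_mxP; eexists; split; [exact: e1 | apply: mulmx1C].
rewrite eM map_mxM !map_block_mx !map_mx0 !map_mx1.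
apply: unit_classM; first by apply: unit_class_lower; apply: unit_class1.
apply: unit_class_upper; last exact: IHn.
apply: unit_class_rank1; apply/invertible_mxP; exists (map_mx iota a').
by rewrite -!map_mxM a'a aa' map_mx1.
Qed.

Lemma local_unit_class n (M : 'M[A]_n) :
  invertible M -> unit_class (map_mx iota M).
Proof.
elim: n M => [|n IHn] M.
  have -> : map_mx iota M = 1%:M by apply/matrixP; case.
  by move=> _; apply: unit_class1.
rewrite -[n.+1]/(1 + n)%N in M *; rewrite -[M]submxK.
move: (ulsubmx M) (ursubmx M) (dlsubmx M) (drsubmx M) => a b c d iM.
have [N [NM MN]] := invertible_mxP _ iM.
move: (NM); rewrite -[N]submxK mulmx_block [1%:M]scalar_mx_block.
move=> /eq_block_mx[e _ _ _].
have inv11 (x : 'M[A]_1) : invertible (x 0 0) -> invertible x.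
  move=> /asboolP[y [yx xy]]; apply/invertible_mxP; exists y%:M.
  by rewrite [x]mx11_scalar -!scalar_mxM yx xy.
have : invertible ((ulsubmx N *m a) 0 0 + (ursubmx N *m c) 0 0).
  have := congr1 (fun x : 'M_1 => x 0 0) e; rewrite mxE => ->.
  by rewrite mxE; apply: invertible1.
case/local_add => [/inv11 ia|/inv11/invertible_mxP[y [yx xy]]].
  apply: unit_class_pivot => //.
  have [z [zx xz]] := invertible_mxP _ ia.
  have za : z *m ulsubmx N *m a = 1%:M by rewrite -mulmxA zx.
  by apply/invertible_mxP; exists (z *m ulsubmx N); rewrite za (mulmx1C za).
(* The first column of M generates the unit ideal; when its top entry is not a
   unit, adding v times the rest of the column turns it into 1. *)
pose v := (1%:M - a) *m y *m ursubmx N.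
pose T (u : 'M[A]_(1, n)) : 'M[A]_(1 + n) := block_mx 1%:M u 0 1%:M.
have TN u : T (- u) *m T u = 1%:M.
  rewrite mulmx_block !mulmx0 !mul0mx !mulmx1 !mul1mx !addr0 !add0r addrN.
  by rewrite -scalar_mx_block.
have TuC u : unit_class (map_mx iota (T u)).
  rewrite map_block_mx !map_mx1 map_mx0.
  by apply: unit_class_upper; apply: unit_class1.
apply: (unit_class_divl (TuC v)); rewrite -map_mxM mulmx_block.
apply: unit_class_pivot => //.
  have -> : 1%:M *m a + v *m c = 1%:M.
    by rewrite mul1mx -!mulmxA yx mulmx1 addrC subrK.
  by apply/invertible_mxP; exists 1%:M; rewrite mulmx1.
rewrite -mulmx_block; apply/invertible_mxP; exists (N *m T (- v)).
have h : N *m T (- v) *m (T v *m block_mx a b c d) = 1%:M.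
  by rewrite mulmxA -[N *m _ *m _]mulmxA TN mulmx1.
by rewrite h (mulmx1C h).
Qed.

End LocalElimination.

Lemma det_K1_class (C : comPzRingType) n (U : units 'M[C]_n) :
  det_K1 (K1_class U) = det_unit U.
Proof. exact: etrans (det_K1E _) (det_GLE _). Qed.

Lemma det_K1_iso (C : comPzRingType) :
  (forall n (M : 'M[C]_n), invertible M -> unit_class M) ->
  group_isomorphism (@det_K1 C).
Proof.
move=> uC; have i1 (u : units C) : invertible ((val u)%:M : 'M[C]_1).
  have [v [vu uv]] := asboolW (valP u).
  by apply/invertible_mxP; exists v%:M; rewrite -!scalar_mxM vu uv.
split; first exact: det_K1M.
exists (fun u => K1_class (Units (i1 u))) => [x|u]; last first.
  by apply: val_inj; rewrite det_K1_class /= det_scalar1.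
rewrite -[x]ab_classK; move: (repr x); apply: GL_W => n A.
have [U eU [V eV]] := uC n _ (valP A).
have {eU} <- : U = A by apply: val_inj.
rewrite -[ab_class _]/(K1_class U) eV; rewrite det_K1_class.
congr K1_class; apply: val_inj => /=.
by rewrite det_mx11 -mx11_scalar.
Qed.

(** * Finite free resolutions *)

Definition mx_in (R : Type) (I : R -> Prop) m n (X : 'M[R]_(m, n)) :=
  forall i j, I (X i j).

(** The cokernel of D, as a module over the quotient of the ring S by the ideal
    I, has a finite free resolution.  Keeping S and I as predicates on one ring
    lets all matrices live over that ring, whatever is inverted or killed. *)
Inductive finite_res (R : comPzRingType) (S : {pred R}) (I : R -> Prop) :
    forall m n, 'M[R]_(m, n) -> Prop :=
| finite_res_inj m n (D : 'M[R]_(m, n)) :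
    (forall u : 'rV_m, u \is a mxOver S -> mx_in I (u *m D) -> mx_in I u) ->
    finite_res S I D
| finite_res_step m n k (D : 'M[R]_(m, n)) (K : 'M[R]_(k, m)) :
    K \is a mxOver S ->
    (forall u : 'rV_m, u \is a mxOver S ->
      (mx_in I (u *m D) <->
       exists2 v : 'rV_k, v \is a mxOver S & mx_in I (u - v *m K))) ->
    finite_res S I K -> finite_res S I D.

(** * Lattices and their syzygies *)

Section Lattices.
Variables (C : comPzRingType) (B : subringClosed C).

Lemma row_mx_over m n p (X : 'M[C]_(m, n)) (Y : 'M[C]_(m, p)) :
  (row_mx X Y \is a mxOver B) = (X \is a mxOver B) && (Y \is a mxOver B).
Proof.
apply/mxOverP/andP => [h|[/mxOverP hX /mxOverP hY] i j].
  split; apply/mxOverP => i j.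
    by have := h i (lshift p j); rewrite row_mxEl.
  by have := h i (rshift n j); rewrite row_mxEr.
by case: (split_ordP j) => k ->; rewrite ?row_mxEl ?row_mxEr.
Qed.

Lemma col_mx_over m n p (X : 'M[C]_(m, n)) (Y : 'M[C]_(p, n)) :
  (col_mx X Y \is a mxOver B) = (X \is a mxOver B) && (Y \is a mxOver B).
Proof.
apply/mxOverP/andP => [h|[/mxOverP hX /mxOverP hY] i j].
  split; apply/mxOverP => i j.
    by have := h (lshift p i) j; rewrite col_mxEu.
  by have := h (rshift m i) j; rewrite col_mxEd.
by case: (split_ordP i) => k ->; rewrite ?col_mxEu ?col_mxEd.
Qed.

Lemma over1 n : (1%:M : 'M[C]_n) \is a mxOver B.
Proof. by rewrite mxOver_scalar ?rpred0 ?rpred1. Qed.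

Lemma over_rows m n (X : 'M[C]_(m, n)) :
  (forall i, row i X \is a mxOver B) -> X \is a mxOver B.
Proof.
by move=> h; apply/mxOverP => i j; have /mxOverP/(_ 0 j) := h i; rewrite mxE.
Qed.

Lemma row_over m n (X : 'M[C]_(m, n)) i :
  X \is a mxOver B -> row i X \is a mxOver B.
Proof. by move=> /mxOverP h; apply/mxOverP => j k; rewrite mxE. Qed.

Definition row_span m n (D : 'M[C]_(m, n)) (w : 'rV_n) : Prop :=
  exists2 u : 'rV_m, u \is a mxOver B & w = u *m D.

Definition submodule n (W : 'rV[C]_n -> Prop) : Prop :=
  W 0 /\ forall a x y, a \in B -> W x -> W y -> W (a *: x + y).

Lemma submoduleD n (W : 'rV[C]_n -> Prop) x y :
  submodule W -> W x -> W y -> W (x + y).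
Proof. by case=> _ h Wx Wy; rewrite -[x]scale1r; apply: h; rewrite ?rpred1. Qed.

Lemma submoduleZ n (W : 'rV[C]_n -> Prop) a x :
  submodule W -> a \in B -> W x -> W (a *: x).
Proof. by case=> W0 h Wx Wy; rewrite -[_ *: _]addr0; apply: h. Qed.

Lemma submoduleB n (W : 'rV[C]_n -> Prop) x y :
  submodule W -> W x -> W y -> W (x - y).
Proof.
by case=> _ h Wx Wy; rewrite addrC -scaleN1r; apply: h; rewrite ?rpredN1.
Qed.

Lemma submodule_mul n (W : 'rV[C]_n -> Prop) m (X : 'M_(m, n)) (u : 'rV_m) :
  submodule W -> (forall i, W (row i X)) -> u \is a mxOver B -> W (u *m X).
Proof.
move=> sW hX /mxOverP hu; rewrite mulmx_sum_row.
by elim/big_ind: _ => [|x y|i _];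
  [case: sW | apply: submoduleD | apply: submoduleZ].
Qed.

Lemma span_submodule m n (D : 'M[C]_(m, n)) : submodule (row_span D).
Proof.
split; first by exists 0; rewrite ?mul0mx ?rpred0.
move=> a _ _ aB [u uB ->] [v vB ->]; exists (a *: u + v).
  by rewrite rpredD // mxOverZ.
by rewrite mulmxDl scalemxAl.
Qed.

Lemma span_row m n (D : 'M[C]_(m, n)) i : row_span D (row i D).
Proof. by exists (row i 1%:M); rewrite ?row_over ?over1 // -row_mul mul1mx. Qed.

Lemma span_coeffs m n k (D : 'M[C]_(m, n)) (E : 'M[C]_(k, n)) :
  (forall i, row_span D (row i E)) ->
  exists2 a : 'M[C]_(k, m), a \is a mxOver B & E = a *m D.
Proof.
move=> h; have h' i : {u : 'rV_m | u \is a mxOver B /\ row i E = u *m D}.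
  by apply: cid; have [u uB e] := h i; exists u.
exists (\matrix_i sval (h' i)).
  by apply: over_rows => i; rewrite rowK; case: (svalP (h' i)).
by apply/row_matrixP => i; rewrite row_mul rowK; case: (svalP (h' i)).
Qed.

(** Syzygies of the lattice W: the rows of D generate W, the matrix
    [sigma *m D] is the basis of a free sublattice F, and the next lattice
    consists of the vectors u with u D in F.  This is the kernel of the
    presentation of W / F by the rows of D.  The class of the basis of F being
    that of a unit, the invariant of W changes only by a sign.  The depth p is
    explicit so that the resolutions of two lattices can be kept in step. *)
Fixpoint null_lattice p n (W : 'rV[C]_n -> Prop) : Prop :=
  if p is p'.+1 then
    exists m (D : 'M[C]_(m, n)) (sigma : 'M[C]_(n, m)),
      [/\ unit_class (sigma *m D), sigma \is a mxOver B,
          forall w, W w <-> row_span D w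
        & null_lattice p' (fun u => u \is a mxOver B /\ row_span
          (sigma *m D) (u *m D))]
  else exists2 Q : 'M[C]_n, unit_class Q & forall w, W w <-> row_span Q w.

Lemma null_eq p n (W W' : 'rV[C]_n -> Prop) :
  (forall w, W w <-> W' w) -> null_lattice p W -> null_lattice p W'.
Proof. by move=> e; have -> : W = W' by apply/funext=> w; apply/propext. Qed.

Lemma null_full p n : null_lattice p (fun w : 'rV[C]_n => w \is a mxOver B).
Proof.
have span1 (w : 'rV[C]_n) : w \is a mxOver B <-> row_span 1%:M w.
  by split=> [h|[u h ->]]; [exists w | ]; rewrite ?mulmx1.
elim: p => [|p IHp]; first by exists 1%:M => //; apply: unit_class1.
exists n, 1%:M, 1%:M; split=> //; rewrite ?over1 // mulmx1.
  exact: unit_class1.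
by apply: null_eq IHp => w; rewrite mulmx1 -span1; split=> [|[]].
Qed.

Lemma nullS p n (W : 'rV[C]_n -> Prop) : null_lattice p W ->
  null_lattice p.+1 W.
Proof.
elim: p n W => [|p IHp] n W.
  move=> [Q uQ eW]; exists n, Q, 1%:M; rewrite mul1mx; split=> //.
    exact: over1.
  apply: null_eq (null_full 0 n) => w; split=> [hw|[]//].
  by split=> //; exists w.
move=> [m [D [sigma [uQ sB eW nV]]]]; exists m, D, sigma; split=> //.
exact: IHp.
Qed.

Lemma null_leq p q n (W : 'rV[C]_n -> Prop) : (p <= q)%N -> null_lattice p W ->
  null_lattice q W.
Proof.
by move/subnK <-; elim: (q - p)%N => //= k IHk nW; apply/nullS/IHk.
Qed.

Section Extension.
Variables (n1 n2 : nat) (W1 : 'rV[C]_n1 -> Prop) (W2 : 'rV[C]_n2 -> Prop).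
Variable W : 'rV[C]_(n1 + n2) -> Prop.

(** W is an extension of W2 by W1 inside the standard split extension of free
    modules; W1 is the kernel and W2 the image of the second projection. *)
Definition extension := [/\ submodule W,
  forall x, W1 x <-> W (row_mx x 0) & forall y, W2 y <->
    exists x, W (row_mx x y)].

Lemma extension_lift m2 (D2 : 'M[C]_(m2, n2)) : extension ->
  (forall w, W2 w <-> row_span D2 w) ->
  exists X : 'M[C]_(m2, n1), forall i, W (row i (row_mx X D2)).
Proof.
move=> [_ _ hW2] e2.
have h i : {x : 'rV_n1 | W (row_mx x (row i D2))}.
  by apply: cid; apply/hW2/e2/span_row.
exists (\matrix_i sval (h i)) => i; rewrite row_row_mx rowK.
exact: svalP (h i).
Qed.

Lemma extension_span m1 m2 (D1 : 'M[C]_(m1, n1)) (D2 : 'M[C]_(m2, n2)) X :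
  extension -> (forall w, W1 w <-> row_span D1 w) ->
    (forall w, W2 w <-> row_span D2 w) ->
  (forall i, W (row i (row_mx X D2))) ->
  forall w, W w <-> row_span (block_mx D1 0 X D2) w.
Proof.
move=> [sW hW1 hW2] e1 e2 hX w; split=> [Ww|[u]].
  have [u2 u2B ew2] : row_span D2 (rsubmx w).
    by apply/e2/hW2; exists (lsubmx w); rewrite hsubmxK.
  have [u1 u1B ew1] : row_span D1 (lsubmx w - u2 *m X).
    apply/e1/hW1; have := submoduleB sW Ww (submodule_mul sW hX u2B).
    by rewrite -{1}[w]hsubmxK mul_mx_row opp_row_mx add_row_mx -ew2 addrN.
  exists (row_mx u1 u2); first by rewrite row_mx_over u1B.
  rewrite mul_row_block mulmx0 add0r -ew1 -ew2 subrK.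
  by rewrite hsubmxK.
rewrite -[u]hsubmxK row_mx_over => /andP[u1B u2B] ->.
rewrite mul_row_block mulmx0 -add_row_mx -mul_mx_row.
apply: submoduleD => //; last exact: submodule_mul.
by apply/hW1/e1; exists (lsubmx u).
Qed.

End Extension.

(** The horseshoe lemma: generators of W1 and lifted generators of W2 generate
    W, free sublattices combine in the same way, and the syzygies of W form
    again an extension of those of W2 by those of W1. *)
Lemma null_extension p n1 n2
  (W1 : 'rV[C]_n1 -> Prop) (W2 : 'rV[C]_n2 -> Prop) W :
  extension W1 W2 W -> null_lattice p W1 -> null_lattice p W2 ->
    null_lattice p W.
Proof.
elim: p n1 n2 W1 W2 W => [|p IHp] n1 n2 W1 W2 W eW.
  move=> [Q1 uQ1 e1] [Q2 uQ2 e2]; have [X hX] := extension_lift eW e2.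
  exists (block_mx Q1 0 X Q2); first exact: unit_class_lower.
  exact: (extension_span eW e1 e2 hX).
move=> [m1 [D1 [s1 [uQ1 s1B e1 nV1]]]] [m2 [D2 [s2 [uQ2 s2B e2 nV2]]]].
have [X hX] := extension_lift eW e2.
have eQ : block_mx s1 0 0 s2 *m block_mx D1 0 X D2
          = block_mx (s1 *m D1) 0 (s2 *m X) (s2 *m D2).
  by rewrite mulmx_block !mul0mx !mulmx0 !addr0 !add0r.
exists (m1 + m2)%N, (block_mx D1 0 X D2), (block_mx s1 0 0 s2).
rewrite eQ; split; first exact: unit_class_lower.
- by rewrite col_mx_over !row_mx_over s1B s2B !rpred0.
- exact: (extension_span eW e1 e2 hX).
apply: IHp nV1 nV2.
have [sW hW1 hW2] := eW.
have uniqQ n (Q : 'M[C]_n) (x : 'rV_n) : unit_class Q -> 0 = x *m Q -> x = 0.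
  move=> /unit_class_invertible/invertible_mxP[Q' [_ QQ']] e.
  by rewrite -[x]mulmx1 -QQ' mulmxA -e mul0mx.
split.
- split; first by rewrite rpred0 mul0mx; split=> //; case: (span_submodule
    (block_mx (s1 *m D1) 0 (s2 *m X) (s2 *m D2))).
  move=> a x y aB [xB hx] [yB hy]; split; first by rewrite rpredD // mxOverZ.
  by rewrite mulmxDl -scalemxAl; apply: (span_submodule _).2.
- move=> x; rewrite row_mx_over rpred0 andbT mul_row_block !mul0mx mulmx0
  !addr0.
  split=> -[xB [u uB e]]; split=> //.
    exists (row_mx u 0); first by rewrite row_mx_over uB rpred0.
    by rewrite mul_row_block !mul0mx mulmx0 !addr0 e.
  move: e uB; rewrite -[u]hsubmxK mul_row_block mulmx0 add0r.
  case/eq_row_mx=> e1' /uniqQ e2'; rewrite row_mx_over => /andP[uB _].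
  by exists (lsubmx u) => //; rewrite e1' e2' // mul0mx addr0.
- move=> y; split=> [[yB [z zB ey]]|[x]]; last first.
    rewrite row_mx_over mul_row_block => -[/andP[xB yB]] [u].
    rewrite -[u]hsubmxK mul_row_block row_mx_over !mulmx0 !add0r.
    move=> /andP[_ uB] /eq_row_mx[_ e]; split=> //.
    by exists (rsubmx u).
  have [x xB ex] : row_span D1 ((y - z *m s2) *m X).
    apply/e1/hW1.
    have -> : row_mx ((y - z *m s2) *m X) 0 = (y - z *m s2) *m row_mx X D2.
      by rewrite mul_mx_row [(_ - _) *m D2]mulmxBl ey mulmxA subrr.
    by apply: submodule_mul => //; rewrite rpredB // mxOverM.
  exists (- x); rewrite row_mx_over rpredN xB yB; split=> //.
  exists (row_mx 0 z); first by rewrite row_mx_over rpred0.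
  rewrite !mul_row_block !mulmx0 !mul0mx !add0r -ey mulNmx -ex mulmxBl opprB.
  by rewrite subrK mulmxA.
Qed.

Lemma null_stab p n k (W : 'rV[C]_n -> Prop) : submodule W ->
  null_lattice p W ->
  null_lattice p (fun x : 'rV[C]_(n + k) =>
    W (lsubmx x) /\ rsubmx x \is a mxOver B).
Proof.
move=> sW nW; apply: null_extension nW (null_full p k).
split.
- split; first by rewrite !linear0 rpred0; split=> //; case: sW.
  move=> a x y aB [Wx xB] [Wy yB]; rewrite !linearP /=; split.
    exact: sW.2.
  by rewrite rpredD // mxOverZ.
- by move=> x; rewrite row_mxKl row_mxKr rpred0; split=> [|[]].
- move=> y; split=> [yB|[x]]; last by rewrite row_mxKr => -[].
  by exists 0; rewrite row_mxKl row_mxKr; split=> //; case: sW.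
Qed.

Hypothesis unit_class_over : forall n (M N : 'M[C]_n),
  M \is a mxOver B -> N \is a mxOver B -> M *m N = 1%:M -> unit_class M.

(** If W is free with basis M and the rows of D generate W, then D = b M and
    M = a D with a b = 1, so b is a split surjection onto B^n and the syzygies
    of W are stably free.  The involution [Th] below identifies B^(m + n) with
    itself so that their sum with B^n is spanned by diag(1, q) Th, where
    q M is the chosen basis of the sublattice.  By induction q has the class of
    a unit, hence so does M. *)
Lemma null_unit_class p n (W : 'rV[C]_n -> Prop) (M : 'M[C]_n) :
  null_lattice p W -> invertible M -> (forall w, W w <-> row_span M w) ->
    unit_class M.
Proof.
elim: p n W M => [|p IHp] n W M.
  move=> [Q uQ eWQ] /invertible_mxP[M' [M'M MM']] eWM.
  have [a aB eM] : exists2 a : 'M_n, a \is a mxOver B & M = a *m Q.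
    by apply: span_coeffs => i; apply/eWQ/eWM/span_row.
  have [b bB eQ] : exists2 b : 'M_n, b \is a mxOver B & Q = b *m M.
    by apply: span_coeffs => i; apply/eWM/eWQ/span_row.
  have ab : a *m b = 1%:M.
    by rewrite -[a *m b]mulmx1 -MM' !mulmxA -[a *m b *m M]mulmxA -eQ -eM.
  by rewrite eM; apply: unit_classM => //; apply: unit_class_over ab.
move=> [m [D [s [uQ sB eWD nV]]]] iM eWM.
have [M' [M'M MM']] := invertible_mxP _ iM.
have [a aB eM] : exists2 a : 'M_(n, m), a \is a mxOver B & M = a *m D.
  by apply: span_coeffs => i; apply/eWD/eWM/span_row.
have [b bB eD] : exists2 b : 'M_(m, n), b \is a mxOver B & D = b *m M.
  by apply: span_coeffs => i; apply/eWM/eWD/span_row.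
have cancM k (x y : 'M_(k, n)) : x *m M = y *m M -> x = y.
  by move=> e; rewrite -[x]mulmx1 -[y]mulmx1 -MM' !mulmxA e.
have ab : a *m b = 1%:M by apply: cancM; rewrite -mulmxA -eD -eM mul1mx.
pose q := s *m b; have qB : q \is a mxOver B by rewrite mxOverM.
have eQ : s *m D = q *m M by rewrite -mulmxA -eD.
have iq : invertible q.
  have /invertible_mxP[Q' [Q'Q QQ']] := unit_class_invertible uQ.
  have h : q *m (M *m Q') = 1%:M by rewrite mulmxA -eQ.
  by apply/invertible_mxP; exists (M *m Q'); rewrite h (mulmx1C h).
suff uq : unit_class q by move: uQ; rewrite eQ; apply: unit_class_divl.
pose Th : 'M[C]_(m + n) := block_mx (1%:M - b *m a) b a 0.
pose dq : 'M[C]_(m + n) := block_mx 1%:M 0 0 q.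
have bab : (1%:M - b *m a) *m b = 0.
  by rewrite mulmxBl mul1mx -mulmxA ab mulmx1 subrr.
have aba : a *m (1%:M - b *m a) = 0.
  by rewrite mulmxBr mulmx1 mulmxA ab mul1mx subrr.
have ThTh : Th *m Th = 1%:M.
  rewrite mulmx_block bab aba ab !mulmx0 !mul0mx !addr0 mulmxBr mulmx1.
  by rewrite mulmxA bab mul0mx subr0 subrK -scalar_mx_block.
have ThB : Th \is a mxOver B.
  by rewrite col_mx_over !row_mx_over rpred0 aB bB !andbT rpredB ?over1 //
    mxOverM.
have dqB : dq \is a mxOver B.
  by rewrite col_mx_over !row_mx_over over1 !rpred0.
have uTh : unit_class Th by apply: unit_class_over ThTh.
apply: (unit_class_upper_dr iq (X := 0 : 'M_(m, n))); rewrite -/dq.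
apply: (unit_class_divr uTh).
have idq : invertible (dq *m Th).
  have /invertible_mxP[q' [q'q qq']] := iq.
  have h : dq *m Th *m (Th *m block_mx 1%:M 0 0 q') = 1%:M.
    rewrite mulmxA -[dq *m Th *m Th]mulmxA ThTh mulmx1 mulmx_block.
    by rewrite !mulmx0 !mul0mx mulmx1 qq' !addr0 add0r -scalar_mx_block.
  by apply/invertible_mxP; eexists; split; last exact: h; apply: mulmx1C.
apply: IHp (null_stab n _ nV) idq _ => [|x].
  split; first by rewrite rpred0 mul0mx; split=> //;
    case: (span_submodule (s *m D)).
  move=> c x y cB [xB hx] [yB hy]; split; first by rewrite rpredD // mxOverZ.
  by rewrite mulmxDl -scalemxAl; apply: (span_submodule _).2.
have spanQ (u : 'rV_m) : row_span (s *m D) (u *m D) <-> row_span q (u *m b).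
  rewrite eD !mulmxA; split=> -[z zB e]; exists z => //.
    by apply: cancM; rewrite e !mulmxA.
  by rewrite e !mulmxA.
rewrite spanQ; split=> [[[uB [z zB ez]] wB]|[y yB ->]].
  move: uB wB ez; rewrite -{4}[x]hsubmxK.
  move: (lsubmx x) (rsubmx x) => u w uB wB ez.
  exists (row_mx (u *m (1%:M - b *m a) + w *m a) z).
    by rewrite row_mx_over zB andbT rpredD // mxOverM // rpredB ?over1 //
      mxOverM.
  rewrite mulmxA; suff -> : row_mx (u *m (1%:M - b *m a) + w *m a) z *m dq
      = row_mx u w *m Th by rewrite -mulmxA ThTh mulmx1.
  by rewrite !mul_row_block !mulmx0 !mulmx1 !addr0 add0r -ez.
move: yB; rewrite -[y]hsubmxK row_mx_over => /andP[y1B y2B].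
rewrite mulmxA !mul_row_block !mulmx0 mulmx1 !addr0 add0r row_mxKl row_mxKr.
split; last by rewrite mxOverM.
split.
  by rewrite rpredD // mxOverM ?mxOverM // rpredB ?over1 // mxOverM.
exists (rsubmx y) => //.
by rewrite mulmxDl -!mulmxA bab mulmx0 add0r ab mulmx1.
Qed.


(** * Inverting one element *)

Variable s : C.
Hypotheses (sB : s \in B) (inv_s : invertible s).

Definition subring_multiple (c : C) : Prop := exists2 b, b \in B & c = s * b.

Lemma mx_in_subring_multiple m n (X : 'M[C]_(m, n)) :
  mx_in subring_multiple X <->
  exists2 Y : 'M[C]_(m, n), Y \is a mxOver B & X = s *: Y.
Proof.
split=> [h|[Y /mxOverP YB ->] i j]; last by rewrite mxE; exists (Y i j).
have h' i j : {b | b \in B /\ X i j = s * b}.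
  by apply: cid; have [b bB e] := h i j; exists b.
exists (\matrix_(i, j) sval (h' i j)).
  by apply/mxOverP => i j; rewrite mxE; case: (svalP (h' i j)).
by apply/matrixP => i j; rewrite !mxE; case: (svalP (h' i j)).
Qed.

(** The preimage in B^n of the submodule of (B/s)^n generated by the rows of
    E. *)
Definition mod_span m n (E : 'M[C]_(m, n)) (v : 'rV_n) :=
  exists2 u : 'rV_m, u \is a mxOver B & mx_in subring_multiple (v - u *m E).

Lemma mod_span_row_span m n (E : 'M[C]_(m, n)) (v : 'rV_n) :
  mod_span E v <-> row_span (col_mx E s%:M) v.
Proof.
split=> [[u uB /mx_in_subring_multiple[b bB e]]|[u]].
  exists (row_mx u b); first by rewrite row_mx_over uB.
  by rewrite mul_row_col mul_mx_scalar -e addrC subrK.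
rewrite -[u]hsubmxK row_mx_over => /andP[u1B u2B] ->.
exists (lsubmx u) => //; apply/mx_in_subring_multiple; exists (rsubmx u) => //.
by rewrite mul_row_col mul_mx_scalar addrC addKr.
Qed.

Lemma mod_span_over m n (E : 'M[C]_(m, n)) (v : 'rV_n) :
  E \is a mxOver B -> mod_span E v -> v \is a mxOver B.
Proof.
move=> EB [u uB /mx_in_subring_multiple[b bB e]].
rewrite -[v](subrK (u *m E)) e rpredD //; last by rewrite mxOverM.
by rewrite mxOverZ.
Qed.

(** Taking E and s as generators and s B^n as sublattice, the syzygies are those
    of E over B/s, plus a free summand; the resolution ends with the lattice
    s B^m, whose basis s has the class of a unit. *)
Lemma null_mod_span m n (E : 'M[C]_(m, n)) :
  E \is a mxOver B -> finite_res B subring_multiple E ->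
    exists p, null_lattice p (mod_span E).
Proof.
move=> EB fE; elim: fE EB => {m n E} [m n E injE|m n k E K KB kerE _ IHK] EB.
  exists 1%N, (m + n)%N, (col_mx E s%:M), (row_mx 0 1%:M).
  have eQ : row_mx 0 1%:M *m col_mx E s%:M = s%:M.
    by rewrite mul_row_col mul0mx mul1mx add0r.
  rewrite eQ; split; first exact: unit_class_scalar.
  - by rewrite row_mx_over rpred0 over1.
  - exact: mod_span_row_span.
  exists (block_mx s%:M 0 0 1%:M).
    by apply: unit_class_lower; [apply: unit_class_scalar | apply: unit_class1].
  move=> w; rewrite -[w]hsubmxK; move: (lsubmx w) (rsubmx w) => {w} u a.
  rewrite mul_row_col mul_mx_scalar row_mx_over; split.
    move=> [/andP[uB aB] [b bB]]; rewrite mul_mx_scalar => e.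
    have /mx_in_subring_multiple[u' u'B ->] : mx_in subring_multiple u.
      apply: injE => //; apply/mx_in_subring_multiple; exists (b - a).
        by rewrite rpredB.
      by rewrite scalerBr -e addrK.
    exists (row_mx u' a); first by rewrite row_mx_over u'B.
    by rewrite mul_row_block mul_mx_scalar !mulmx0 mulmx1 addr0 add0r.
  move=> [y]; rewrite -[y]hsubmxK row_mx_over => /andP[y1B y2B].
  rewrite mul_row_block mul_mx_scalar !mulmx0 mulmx1 addr0 add0r.
  move=> /eq_row_mx[-> ->]; rewrite mxOverZ // y2B; split=> //.
  exists (lsubmx y *m E + rsubmx y); first by rewrite rpredD // mxOverM.
  by rewrite mul_mx_scalar scalerDr scalemxAl.
have [p nK] := IHK KB.
exists p.+1, (m + n)%N, (col_mx E s%:M), (row_mx 0 1%:M).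
have eQ : row_mx 0 1%:M *m col_mx E s%:M = s%:M.
  by rewrite mul_row_col mul0mx mul1mx add0r.
rewrite eQ; split; first exact: unit_class_scalar.
- by rewrite row_mx_over rpred0 over1.
- exact: mod_span_row_span.
have sK : submodule (mod_span K).
  have [z h] := span_submodule (col_mx K s%:M).
  split; first exact/mod_span_row_span.
  by move=> a x y aB /mod_span_row_span hx /mod_span_row_span hy;
    apply/mod_span_row_span/h.
apply: null_eq (null_stab n sK nK) => w.
rewrite -{3 4}[w]hsubmxK; move: (lsubmx w) (rsubmx w) => {w} u a.
rewrite mul_row_col mul_mx_scalar row_mx_over; split.
  move=> [rK aB]; have uB := mod_span_over KB rK; rewrite uB; split=> //.
  have /mx_in_subring_multiple[b bB ->] : mx_in subring_multiple
    (u *m E) by apply/(kerE _ uB).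
  exists (b + a); first by rewrite rpredD.
  by rewrite mul_mx_scalar scalerDr.
move=> [/andP[uB aB] [b bB]]; rewrite mul_mx_scalar => e; split=> //.
apply/(kerE _ uB)/mx_in_subring_multiple; exists (b - a);
  first by rewrite rpredB.
by rewrite scalerBr -e addrK.
Qed.

Hypothesis kernel_fg : forall m n (D : 'M[C]_(m, n)),
  exists k (K : 'M[C]_(k, m)), K \is a mxOver B /\
    forall u : 'rV_m, u \is a mxOver B -> u *m D = 0 <-> row_span K u.
Hypothesis finite_res_over : forall m n (E : 'M[C]_(m, n)),
  E \is a mxOver B -> finite_res B subring_multiple E.

(** The hypothesis says that the module presented by D modulo E is killed by
    s. *)
Lemma null_preimage m n k (D : 'M[C]_(m, n)) (E : 'M[C]_(k, n)) :
  (forall i, row_span E (s *: row i D)) ->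
  exists p, null_lattice p (fun u => u \is a mxOver B /\ row_span E (u *m D)).
Proof.
move=> hs; have [l [K [KB eK]]] := kernel_fg (col_mx D E).
have [K1B K2B] : lsubmx K \is a mxOver B /\ rsubmx K \is a mxOver B.
  by move: KB; rewrite -{1}[K]hsubmxK row_mx_over => /andP.
have KDE : lsubmx K *m D = - (rsubmx K *m E).
  apply/row_matrixP => i; apply/eqP; rewrite linearN /= !row_mul -addr_eq0.
  rewrite -mul_row_col -row_row_mx hsubmxK; apply/eqP/eK; last exact: span_row.
  exact: row_over.
have [p nK] := null_mod_span K1B (finite_res_over K1B).
exists p; apply: null_eq nK => v; split=> [rv|[vB [z zB e]]].
  split; first exact: mod_span_over rv.
  case: rv => u uB /mx_in_subring_multiple[b bB e].
  rewrite -[v](subrK (u *m lsubmx K)) e mulmxDl -mulmxA KDE mulmxN mulmxA.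
  have sE := span_submodule E.
  rewrite -mulNmx; apply: submoduleD => //; last first.
    by eexists; last reflexivity; rewrite rpredN mxOverM.
  rewrite -scalemxAl scalemxAr; apply: submodule_mul => // i.
  by rewrite linearZ /=; apply: hs.
have /eK : row_mx v (- z) *m col_mx D E =
  0 by rewrite mul_row_col mulNmx e subrr.
rewrite row_mx_over rpredN vB => /(_ zB)[y yB ey].
exists y => //; apply/mx_in_subring_multiple; exists 0; first by rewrite rpred0.
move: ey; rewrite -{1}[K]hsubmxK mul_mx_row => /eq_row_mx[-> _].
by rewrite subrr scaler0.
Qed.

(** Let W' be the sum of the span of M and s W, spanned by [D'], so that W / W'
    is killed by s.  The vectors (u, y) with y + u D in W' form a lattice
    [P] which is an extension of W by syzygies of W / W', so it is null, and
    up to an elementary change of coordinates it is the sum of W' and a free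
    module.  It replaces W when k decreases. *)
Lemma devissage k p m n
    (W : 'rV[C]_n -> Prop) (D : 'M[C]_(m, n)) (M : 'M[C]_n) :
  null_lattice p W -> (forall w, W w <-> row_span D w) -> invertible M ->
  (forall w, row_span M w -> W w) ->
    (forall w, W w -> row_span M (s ^+ k *: w)) ->
  unit_class M.
Proof.
elim: k p m n W D M => [|k IHk] p m n W D M nW eWD iM MW WM.
  apply: null_unit_class nW iM _ => w; split; last exact: MW.
  by move/WM; rewrite scale1r.
pose D' := col_mx M (s *: D).
have sD' : submodule (row_span D') := span_submodule D'.
have sW : submodule W.
  have [z h] := span_submodule D; split; first exact/eWD.
  by move=> a x y aB /eWD hx /eWD hy; apply/eWD/h.
have sDin i : row_span D' (s *: row i D).
  have := span_row D' (rshift n i).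
  by rewrite rowKd linearZ.
have Min w : row_span M w -> row_span D' w.
  move=> [z zB ->]; exists (row_mx z 0); first by rewrite row_mx_over zB rpred0.
  by rewrite mul_row_col mul0mx addr0.
have D'W w : row_span D' w -> W w.
  move=> [z]; rewrite -[z]hsubmxK row_mx_over => /andP[z1B z2B] ->.
  rewrite mul_row_col; apply: submoduleD => //.
    by apply: MW; exists (lsubmx z).
  by rewrite -scalemxAr; apply: submoduleZ => //; apply/eWD; exists (rsubmx z).
have [q nV] := null_preimage sDin.
pose P (x : 'rV[C]_(m + n)) :=
  lsubmx x \is a mxOver B /\ row_span D' (rsubmx x + lsubmx x *m D).
have sP : submodule P.
  split.
    by rewrite /P !linear0 rpred0 mul0mx addr0; split=> //; case: sD'.
  move=> a x y aB [xB hx] [yB hy]; split.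
    by rewrite linearP rpredD // mxOverZ.
  rewrite !linearP /= mulmxDl addrACA -scalemxAl -scalerDr.
  exact: sD'.2.
have nP : null_lattice (maxn q p) P.
  apply: null_extension (null_leq (leq_maxl q p) nV) (null_leq
    (leq_maxr q p) nW).
  split=> //.
    by move=> x; rewrite /P row_mxKl row_mxKr add0r.
  move=> y; split=> [/eWD[t tB ->]|[x]].
    exists (- t); rewrite /P row_mxKl row_mxKr mulNmx subrr rpredN tB.
    by split=> //; case: sD'.
  rewrite /P row_mxKl row_mxKr => -[xB /D'W h].
  rewrite -[y](addrK (x *m D)); apply: submoduleB => //.
  by apply/eWD; exists x.
pose DP : 'M[C]_(m + (n + m), m + n) := block_mx 1%:M (- D) 0 D'.
pose MP : 'M[C]_(m + n) := block_mx 1%:M (- D) 0 M.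
have eDP l (G : 'M[C]_(l, n)) (x : 'rV_(m + n)) :
    row_span (block_mx 1%:M (- D) 0 G) x <->
    lsubmx x \is a mxOver B /\ row_span G (rsubmx x + lsubmx x *m D).
  split=> [[y]|[xB [z zB e]]].
    rewrite -[y]hsubmxK row_mx_over => /andP[y1B y2B].
    rewrite mul_row_block mulmx1 mulmx0 addr0 => ->.
    rewrite row_mxKl row_mxKr mulmxN addrAC addNr add0r; split=> //.
    by exists (rsubmx y).
  exists (row_mx (lsubmx x) z); first by rewrite row_mx_over xB.
  rewrite mul_row_block mulmx1 mulmx0 addr0 mulmxN -e addrC addrK.
  by rewrite hsubmxK.
have iMP : invertible MP.
  have /invertible_mxP[M' [M'M MM']] := iM.
  have h : MP *m block_mx 1%:M (D *m M') 0 M' = 1%:M.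
    rewrite mulmx_block !mulmx0 !mul0mx !mul1mx !addr0 !add0r MM' mulNmx.
    by rewrite subrr -scalar_mx_block.
  by apply/invertible_mxP; eexists; split; last exact: h; apply: mulmx1C.
suff : unit_class MP by apply: unit_class_upper_dr.
apply: IHk nP _ iMP _ _.
- by move=> w; apply: iff_sym; apply: (eDP _ D').
- by move=> w /eDP[wB h]; split=> //; apply: Min.
- move=> w [wB [z zB e]]; apply/eDP; rewrite !linearZ /=.
  split; first by rewrite mxOverZ // rpredX.
  rewrite -scalemxAl -scalerDr e -[z]hsubmxK mul_row_col scalerDr.
  move: zB; rewrite -[z]hsubmxK row_mx_over => /andP[z1B z2B].
  rewrite row_mxKl row_mxKr; apply: submoduleD (span_submodule M) _ _.
    by apply: submoduleZ (span_submodule M) _ _;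
      [apply: rpredX | exists (lsubmx z)].
  rewrite -scalemxAr scalerA -exprSr; apply: WM.
  by apply/eWD; exists (rsubmx z).
Qed.

Lemma unit_class_away n (M N : 'M[C]_n) k l :
  s ^+ k *: M \is a mxOver B -> s ^+ l *: N \is a mxOver B -> M *m N = 1%:M ->
  unit_class M.
Proof.
move=> MB NB MN; have NM := mulmx1C MN.
have isk (j : nat) : unit_class ((s ^+ j)%:M : 'M[C]_n).
  apply: unit_class_scalar; case/asboolP: inv_s => s' [s's ss'].
  by apply/asboolP; exists (s' ^+ j);
    rewrite -!exprMn_comm ?s's ?ss' ?expr1n //;
    apply: mulrC.
apply: (unit_class_divl (isk k)); rewrite mul_scalar_mx.
have iM : invertible (s ^+ k *: M).
  have [S [S1 S2]] := invertible_mxP _ (unit_class_invertible (isk k)).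
  have h : s ^+ k *: M *m (N *m S) = 1%:M.
    by rewrite -scalemxAl mulmxA MN mul1mx -mul_scalar_mx.
  by apply/invertible_mxP; eexists; split; last exact: h; apply: mulmx1C.
apply: (@devissage (k + l) 0%N n n (fun w => w \is a mxOver B) 1%:M _ _ _ iM).
- exact: null_full.
- by move=> w; split=> [h|[u h ->]]; [exists w|]; rewrite ?mulmx1.
- by move=> w [u uB ->]; rewrite mxOverM.
- move=> w wB; exists (w *m (s ^+ l *: N)); first by rewrite mxOverM.
  rewrite -!scalemxAr -scalemxAl scalerA -exprD.
  by rewrite -mulmxA NM mulmx1 addnC.
Qed.

End Lattices.

(** * Noetherian rings and the principal ideal theorem *)

Section Sets.
Variable R : comPzRingType.
Implicit Types (I J P Q : R -> Prop).

Definition ideal_set I : Prop := I 0 /\ forall a u v, I u -> I v ->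
  I (a * u + v).

Lemma ideal_setD I u v : ideal_set I -> I u -> I v -> I (u + v).
Proof. by case=> _ h Iu Iv; rewrite -[u]mul1r; apply: h. Qed.

Lemma ideal_setM I a u : ideal_set I -> I u -> I (a * u).
Proof. by case=> I0 h Iu; rewrite -[_ * _]addr0; apply: h. Qed.

Lemma ideal_setN I u : ideal_set I -> I u -> I (- u).
Proof. by move=> iI Iu; rewrite -mulN1r; apply: ideal_setM. Qed.

Lemma ideal_setB I u v : ideal_set I -> I u -> I v -> I (u - v).
Proof. by move=> iI Iu Iv; apply: ideal_setD => //; apply: ideal_setN. Qed.

Lemma ideal_setDr I u v : ideal_set I -> I v -> I (u + v) -> I u.
Proof. by move=> iI Iv Iuv; rewrite -(addrK v u); apply: ideal_setB. Qed.

Lemma ideal_set_sum I n (F : 'I_n -> R) : ideal_set I -> (forall i, I (F i)) ->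
  I (\sum_i F i).
Proof.
move=> iI h; elim/big_ind: _ => [|u v|i _]; last exact: h.
  by case: iI.
exact: ideal_setD.
Qed.

Definition prime_set P :=
  [/\ ideal_set P, ~ P 1 & forall u v, P (u * v) -> P u \/ P v].

Lemma prime_prod P n (F : 'I_n -> R) :
  prime_set P -> (forall i, ~ P (F i)) -> ~ P (\prod_i F i).
Proof.
by move=> [_ P1 pP] h; elim/big_ind: _ => // x y hx hy /pP[].
Qed.

Hypothesis noethR : noetherian R.

Lemma noether_fg I : ideal_set I ->
  exists d (x : 'I_d -> R),
    forall y, I y <-> exists c : 'I_d -> R, y = \sum_i c i * x i.
Proof.
move=> [I0 h].
have [|d [x hx]] := noethR (I := [pred y | `[< I y >]]).
  split; first exact/asboolP.
  by move=> a u v /asboolP Iu /asboolP Iv; apply/asboolP/h.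
exists d, x => y; rewrite -hx.
by split=> [Iy|/asboolP //]; apply/asboolP.
Qed.

Lemma noether_max (F : (R -> Prop) -> Prop) I0 :
  (forall I, F I -> ideal_set I) -> F I0 ->
  exists2 J, F J & forall J', F J' -> (forall a, J a -> J' a) ->
    forall a, J' a -> J a.
Proof.
move=> Fi FI0; apply: contrapT => nomax.
have step (J : {J | F J}) : {J' : {J | F J} |
    (forall a, sval J a -> sval J' a) /\ exists a, sval J' a /\ ~ sval J a}.
  apply: cid; case: J => J FJ /=; apply: contrapT => noJ'.
  apply: nomax; exists J => // J' FJ' JJ' a J'a; apply: contrapT => Ja.
  by apply: noJ'; exists (exist _ J' FJ') => /=; split=> //; exists a.
pose f (K : {J | F J}) := sval (step K).
pose s n := sval (iter n f (exist _ I0 FI0)).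
have sstep n : (forall a, s n a -> s n.+1 a) /\ exists a, s n.+1 a /\ ~ s n a.
  exact: svalP (step (iter n f (exist _ I0 FI0))).
have sS n a : s n a -> s n.+1 a := (sstep n).1 a.
have sm n m a : (n <= m)%N -> s n a -> s m a.
  by move/subnK <-; elim: (m - n)%N => //= k IHk /IHk; apply: sS.
have si n : ideal_set (s n) by apply: Fi; apply: svalP.
have [|d [x hx]] := @noether_fg (fun a => exists n, s n a).
  split; first by exists 0%N; case: (si 0%N).
  move=> a u v [n hu] [m hv]; exists (maxn n m); apply: (si _).2.
    exact: sm (leq_maxl _ _) hu.
  exact: sm (leq_maxr _ _) hv.
have xs i : {n | s n (x i)}.
  apply: cid; apply/hx; exists (fun j => (i == j)%:R).
  rewrite (bigD1 i) //= eqxx mul1r big1 ?addr0 // => j /negPf ji.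
  by rewrite eq_sym ji mul0r.
pose N := \max_i sval (xs i).
have sN n a : s n a -> s N a.
  move=> sna; have [c ->] : exists c : 'I_d -> R, a = \sum_i c i * x i.
    by apply/hx; exists n.
  apply: ideal_set_sum => // i; apply: ideal_setM => //.
  by apply: sm (svalP (xs i)); apply: leq_bigmax.
by have [_ [a [/sN sa []]]] := sstep N.
Qed.

End Sets.

Section Whole.
Variable R : comPzRingType.

(** The whole ring as a subring, so that the notions relative to a subring apply
    to it. *)
Definition whole : {pred R} := fun _ => true.

Lemma whole_subring_closed : subring_closed whole. Proof. by []. Qed.

HB.instance Definition _ :=
  GRing.isSubringClosed.Build R whole whole_subring_closed.

Lemma over_whole m n (X : 'M[R]_(m, n)) : X \is a mxOver whole.
Proof. exact/mxOverP. Qed.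

Lemma det_congr (I : R -> Prop) n (X Y : 'M[R]_n) : ideal_set I ->
  (forall i j, I (X i j - Y i j)) -> I (\det X - \det Y).
Proof.
move=> iI h; rewrite -sumrB; elim/big_ind: _ => [|a b|sg _].
- by case: iI.
- exact: ideal_setD.
rewrite -mulrBr; apply: ideal_setM => //.
apply: (big_ind2 (fun a b => I (a - b))) => [|a b c d hab hcd|i _] //.
  by rewrite subrr; case: iI.
have -> : a * c - b * d = c * (a - b) + b * (c - d) by ring.
by apply: ideal_setD => //; apply: ideal_setM.
Qed.

(** The determinant trick, in a form that covers the localization at the prime
    P: the determinant of diag(c) - x U lies outside P because it is congruent
    to the product of the c_i modulo x. *)
Lemma nakayama (P : R -> Prop) x n (S : 'rV[R]_n -> Prop) k (G : 'M[R]_(k, n)) :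
  prime_set P -> P x -> submodule whole S ->
  (forall i, exists c u, ~ P c /\ S (c *: row i G - x *: (u *m G))) ->
  exists2 c, ~ P c & forall i, S (c *: row i G).
Proof.
move=> pP Px sS h; have [iP P1 _] := pP.
have h' i : {cu : R * 'rV[R]_k | ~ P cu.1 /\ S
  (cu.1 *: row i G - x *: (cu.2 *m G))}.
  by apply: cid; have [c [u hcu]] := h i; exists (c, u).
pose c := \row_i (sval (h' i)).1; pose U := \matrix_i (sval (h' i)).2.
pose H := diag_mx c - x *: U.
exists (\det H) => [PH|i]; last first.
  have -> : \det H *: row i G = row i (\adj H) *m (H *m G).
    by rewrite mulmxA -row_mul mul_adj_mx -row_mul mul_scalar_mx linearZ.
  apply: submodule_mul (over_whole _) => // j.
  rewrite row_mul linearB /= row_diag_mx mulmxBl -scalemxAl -rowE linearZ /=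
    rowK.
  by rewrite -scalemxAl mxE; case: (svalP (h' j)).
have [iI _ _] := pP; apply: (@prime_prod _ P _ (fun i => c 0 i) pP).
  by move=> i; rewrite mxE; case: (svalP (h' i)).
rewrite -det_diag -(subKr (\det H) (\det (diag_mx c))).
apply: ideal_setB => //; apply: det_congr => // i j.
rewrite !mxE addrAC subrr add0r mulrC.
by apply: ideal_setN => //; apply: ideal_setM.
Qed.

End Whole.

Section PrincipalIdeal.
Variable R : comPzRingType.
Hypothesis noethR : noetherian R.

Definition strict (P Q : R -> Prop) :=
  (forall a, P a -> Q a) /\ exists2 a, Q a & ~ P a.

(** Krull's principal ideal theorem: when P2 is minimal among the primes
    containing P0 and x, no prime P1 lies strictly between P0 and P2; this
    is obtained in the form P1 x, which minimality refutes.  Localizations are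
    replaced by saturated ideals of the ring itself. *)
Section NoIntermediatePrime.
Variables (P0 P2 : R -> Prop) (x : R).
Hypotheses (pP0 : prime_set P0) (pP2 : prime_set P2) (x2 : P2 x).
Hypothesis minimal : forall Q, prime_set Q -> (forall a, P0 a -> Q a) ->
  (forall a, Q a -> P2 a) -> Q x -> forall a, P2 a -> Q a.

(** The ideals of the localization at P2 that contain P0 and x. *)
Definition admissible (T : R -> Prop) :=
  [/\ ideal_set T, forall c a, ~ P2 c -> T (c * a) -> T a,
      forall a, P0 a -> T a & T x].

Definition saturate (T : R -> Prop) a := exists2 c, ~ P2 c & T (c * a).

Lemma saturate_admissible (T : R -> Prop) :
  ideal_set T -> (forall a, P0 a -> T a) -> T x -> admissible (saturate T).
Proof.
move=> iT T0 Tx; have [iP P1 pP] := pP2.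
split.
- split; first by exists 1; rewrite // mulr0; case: iT.
  move=> a u v [c cP Tc] [d dP Td]; exists (c * d); first by case/pP.
  have -> : c * d * (a * u + v) = (d * a) * (c * u) + c * (d * v) by ring.
  by apply: iT.2 => //; apply: ideal_setM.
- move=> c a cP [d dP Td]; exists (d * c); first by case/pP.
  by rewrite -mulrA.
- by move=> a /T0 Ta; exists 1; rewrite ?mul1r.
- by exists 1; rewrite ?mul1r.
Qed.

Definition stationary_in (J : R -> Prop) := forall T : nat -> R -> Prop,
  (forall n, admissible (T n)) -> (forall n a, T n.+1 a -> T n a) ->
  exists N, forall n, (N <= n)%N -> forall a, T n a -> J a -> T n.+1 a.

(** The localization at P2 modulo P0 and x is Artinian.  Among the ideals J
    inside which descending chains are stationary, a maximal one is the unit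
    ideal: otherwise, a maximal annihilator (J : v) is prime, hence equal to P2,
    and J can be enlarged by v, the added composition factor being simple. *)
Lemma descending_stationary : stationary_in (fun=> True).
Proof.
have [iP P1 pP] := pP2; have [iP0 _ _] := pP0.
pose base a := exists r p, P0 p /\ a = r * x + p.
have ibase : ideal_set base.
  split; first by exists 0, 0; rewrite mul0r addr0; split=> //; case: iP0.
  move=> a u v [r [p [hp ->]]] [r' [p' [hp' ->]]].
  exists (a * r + r'), (a * p + p'); split; [exact: iP0.2 | ring].
pose F J := admissible J /\ stationary_in J.
have F0 : F (saturate base).
  split.
    apply: saturate_admissible => // [a Pa|]; first by exists 0, a;
      rewrite mul0r add0r.
    by exists 1, 0; rewrite mul1r addr0; split=> //; case: iP0.
  move=> T gT _; exists 0%N => n _ a _ [c cP [r [p [Pp e]]]].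
  have [iT sT T0 Tx] := gT n.+1; apply: (sT c) => //; rewrite e.
  by apply: ideal_setD; rewrite //; [apply: ideal_setM | apply: T0].
have [|J [gJ sJ] maxJ] := noether_max noethR (F := F) _ F0.
  by move=> I [[]].
have [iJ satJ J0 Jx] := gJ.
suff J1 : J 1.
  move=> T gT dT; have [N hN] := sJ T gT dT; exists N => n leN a Ta _.
  by apply: hN => //; rewrite -[a]mulr1; apply: ideal_setM.
apply: contrapT => nJ1.
pose F' K := exists2 v, ~ J v & K = fun a => J (a * v).
have [||K [v Jv ->] maxv] := noether_max noethR
  (F := F') (I0 := fun a => J (a * 1)).
- move=> I [v _ ->]; split; first by rewrite mul0r; case: iJ.
  by move=> a u w hu hw; rewrite mulrDl -mulrA; apply: iJ.2.
- by exists 1.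
have P2v : forall a, P2 a -> J (a * v).
  apply: minimal => [|a Pa|a Ja|]; last by rewrite mulrC; apply: ideal_setM.
  - split.
    + split; first by rewrite mul0r; case: iJ.
      by move=> a u w hu hw; rewrite mulrDl -mulrA; apply: iJ.2.
    + by rewrite mul1r.
    move=> a b Jabv; apply: contrapT => /not_orP[Jav []].
    apply: (maxv (fun c => J (c * (a * v)))); first by exists (a * v).
      move=> c; have -> : c * (a * v) = a * (c * v) by ring.
      exact: ideal_setM.
    by rewrite mulrA [b * a]mulrC.
  - by rewrite mulrC; apply: ideal_setM => //; apply: J0.
  - by apply: contrapT => Pa; apply: Jv; apply: (satJ a).
pose Jv' a := exists r j, J j /\ a = j + r * v.
have JJ' a : J a -> saturate Jv' a.
  by move=> Ja; exists 1 => //; exists 0, a; rewrite mul1r mul0r addr0.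
have iJv : ideal_set Jv'.
  split; first by exists 0, 0; rewrite mul0r addr0; split=> //; case: iJ.
  move=> a u w [r [j [hj ->]]] [r' [j' [hj' ->]]].
  exists (a * r + r'), (a * j + j'); split; [exact: iJ.2 | ring].
apply: Jv; apply: (maxJ (saturate Jv')) => //; last first.
  by exists 1 => //; exists 1, 0; rewrite mul1r add0r; split=> //; case: iJ.
split.
  apply: saturate_admissible => // [a /J0 Ja|]; first by exists 0, a;
    rewrite mul0r addr0.
  by exists 0, x; rewrite mul0r addr0.
move=> T gT dT; have [N hN] := sJ T gT dT.
have dTm n m a : (n <= m)%N -> T m a -> T n a.
  by move/subnK <-; elim: (m - n)%N => //= k IHk /dT.
have [[n0 hn0]|hT] := pselect (exists n0, forall a, T n0 a -> saturate Jv' a ->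
  J a).
  exists (maxn N n0) => n; rewrite geq_max => /andP[leN len0] a Ta Ja.
  by apply: hN => //; apply: hn0 => //; apply: dTm Ta.
exists N => n leN w Tw [c cP [r [j [Jj ej]]]].
have [w' [Tw' [c' c'P [r' [j' [Jj' ej']]]] Jw']] :
    exists w', [/\ T n.+1 w', saturate Jv' w' & ~ J w'].
  apply: contrapT => hw'; apply: hT; exists n.+1 => a Ta Ja.
  by apply: contrapT => nJa; apply: hw'; exists a.
(* The coefficient r' of v is invertible at P2, so w' cancels the v-component
   of w. *)
have r'P : ~ P2 r'.
  move=> /P2v hr'; apply: Jw'; apply: (satJ c') => //; rewrite ej'.
  exact: ideal_setD.
have [iT sT T0 Tx] := gT n; have [iTS sTS _ _] := gT n.+1.
apply: (sTS (r' * c)); first by case/pP.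
rewrite -(subrK (r * c' * w') (r' * c * w)); apply: ideal_setD => //;
  last exact: ideal_setM.
apply: hN => //.
  by apply: ideal_setB => //; apply: ideal_setM => //; apply: dT.
have -> : r' * c * w - r * c' * w' = r' * (c * w) - r * (c' * w') by ring.
rewrite ej ej'; have -> : r' * (j + r * v) - r * (j' + r' * v) =
  r' * j - r * j' by ring.
by apply: ideal_setB => //; apply: ideal_setM.
Qed.

(** The ideals S n are the P1-saturations of (y^n) + P0, for y in P1 outside P0.
    By the descending chain condition, S N is contained in S (N + 1) + x S N
    locally at P2 for some N (x can be divided out because it is outside P1), so
    Nakayama's lemma gives S N = S (N + 1).  Then y^N is a multiple of
    y^(N + 1) modulo P0 locally at P1, which is absurd. *)
Lemma no_intermediate_prime (P1 : R -> Prop) :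
  prime_set P1 -> strict P0 P1 -> strict P1 P2 -> P1 x.
Proof.
move=> pP1 [P01 [y y1 y0]] [P12 _]; apply: contrapT => nx.
have [iP0 _ prP0] := pP0; have [iP1 n1 prP1] := pP1; have [iP2 n2 prP2] := pP2.
pose S n a := exists c r p, [/\ ~ P1 c, P0 p & c * a = r * y ^+ n + p].
have iS n : ideal_set (S n).
  split.
    by exists 1, 0, 0; rewrite !mul0r mulr0 addr0; split=> //; case: iP0.
  move=> a u v [c [r [p [cP Pp e]]]] [c' [r' [p' [c'P Pp' e']]]].
  exists (c * c'), (a * c' * r + c * r'), (a * c' * p + c * p'); split.
  - by case/prP1.
  - by apply: iP0.2 => //; apply: ideal_setM.
  - have -> : c * c' * (a * u + v) = a * c' * (c * u) + c * (c' * v) by ring.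
    by rewrite e e'; ring.
have S0 n a : P0 a -> S n a.
  by move=> Pa; exists 1, 0, a; rewrite mul1r mul0r add0r.
have Ssat n c a : ~ P1 c -> S n (c * a) -> S n a.
  move=> cP [d [r [p [dP Pp e]]]]; exists (d * c), r, p; split=> //.
    by case/prP1.
  by rewrite -mulrA.
have Sdec n a : S n.+1 a -> S n a.
  move=> [c [r [p [cP Pp e]]]]; exists c, (r * y), p; split=> //.
  by rewrite e exprS mulrA.
pose Sx n a := exists b r, S n b /\ a = b + r * x.
pose T n := saturate (Sx n).
have gT n : admissible (T n).
  apply: saturate_admissible.
  - split; first by exists 0, 0; rewrite mul0r addr0; split=> //; case: (iS n).
    move=> a u v [b [r [hb ->]]] [b' [r' [hb' ->]]].
    exists (a * b + b'), (a * r + r'); split; [exact: (iS n).2 | ring].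
  - by move=> a Pa; exists a, 0; rewrite mul0r addr0; split=> //; apply: S0.
  - by exists 0, 1; rewrite mul1r add0r; split=> //; case: (iS n).
have dT n a : T n.+1 a -> T n a.
  move=> [c cP [b [r [hb e]]]]; exists c => //; exists b, r; split=> //.
  exact: Sdec.
have [N hN] := descending_stationary gT dT.
have {hN dT gT} SN a : S N a ->
  exists c r, [/\ ~ P2 c, S N r & S N.+1 (c * a - r * x)].
  move=> Sa; have [|c cP [b [r [hb e]]]] := hN N (leqnn N) a _ I.
    by exists 1; rewrite ?mul1r //; exists a, 0; rewrite mul0r addr0.
  exists c, r; split=> //; last by rewrite e addrK.
  apply: (Ssat _ x) => //; rewrite mulrC.
  have -> : r * x = c * a - b by rewrite e addrC addKr.
  by apply: ideal_setB => //; [apply: ideal_setM | apply: Sdec].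
have [d [z hz]] := noether_fg noethR (iS N).
have Sz i : S N (z i).
  apply/hz; exists (fun j => (i == j)%:R).
  rewrite (bigD1 i) //= eqxx mul1r big1 ?addr0 // => j /negPf ji.
  by rewrite eq_sym ji mul0r.
have SS a : S N a -> S N.+1 a.
  have sub1 : submodule (@whole R) (fun w : 'rV[R]_1 => S N.+1 (w 0 0)).
    split; first by rewrite mxE; case: (iS N.+1).
    by move=> e u v _ hu hv; rewrite !mxE; apply: (iS N.+1).2.
  have [|c cP hc] := nakayama (G := \col_i z i) pP2 x2 sub1.
    move=> i; have [c [r [cP Sr h]]] := SN _ (Sz i).
    have /hz[u eu] := Sr; exists c, (\row_j u j); split=> //.
    rewrite !mxE; suff -> : \sum_j (\row_j u j) 0 j * (\col_i z i) j 0 = r.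
      by rewrite [x * r]mulrC.
    by rewrite eu; apply: eq_bigr => j _; rewrite !mxE.
  case/hz=> u ->; apply: (ideal_set_sum (iS N.+1)) => i;
    apply: ideal_setM => //.
  apply: (Ssat _ c); first by move/P12.
  by have := hc i; rewrite !mxE.
have [|c [r [p [cP Pp e]]]] := SS (y ^+ N).
  by exists 1, 1, 0; rewrite !mul1r addr0; split=> //; case: iP0.
have /prP0[] : P0 (y ^+ N * (c - r * y)).
- have -> : y ^+ N * (c - r * y) = p by rewrite mulrBr mulrC e exprS; ring.
  exact: Pp.
- elim: N {SN hz Sz SS e} => [|N IHN]; first by case: pP0.
  by rewrite exprS => /prP0[].
- move/P01 => h; apply: cP; rewrite -(subrK (r * y) c).
  by apply: ideal_setD => //; apply: ideal_setM.
Qed.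

End NoIntermediatePrime.

Lemma intermediate_prime P0 P1 P2 x :
  prime_set P0 -> prime_set P1 -> prime_set P2 -> strict P0 P1 ->
    strict P1 P2 ->
  P2 x -> exists Q, [/\ prime_set Q, strict P0 Q, strict Q P2 & Q x].
Proof.
move=> p0 p1 p2 s01 s12 x2; have [x1|nx1] := pselect (P1 x).
  by exists P1.
apply: contrapT => hQ; apply: (nx1).
apply: (@no_intermediate_prime P0 P2 x) => // Q pQ Q0 Q2 Qx a P2a.
apply: contrapT => nQa; apply: hQ; exists Q; split=> //; last first.
  by split=> //; exists a.
by split=> //; exists x => // /s01.1.
Qed.

End PrincipalIdeal.

(** * Resolutions over regular local rings *)

Lemma prime_set_of (R : comPzRingType) (P : {pred R}) :
  prime_ideal P -> prime_set (fun a => a \in P).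
Proof.
move=> [[P0 h] P1 pP]; split; first by split=> // a u v Pu Pv; apply: h.
  exact/negP.
by move=> u v /pP/orP.
Qed.

Section MxIn.
Variables (R : comPzRingType) (I : R -> Prop).
Hypothesis iI : ideal_set I.

Lemma mx_inD m n (X Y : 'M[R]_(m, n)) : mx_in I X -> mx_in I Y ->
  mx_in I (X + Y).
Proof. by move=> hX hY i j; rewrite mxE; apply: ideal_setD. Qed.

Lemma mx_inN m n (X : 'M[R]_(m, n)) : mx_in I X -> mx_in I (- X).
Proof. by move=> hX i j; rewrite mxE; apply: ideal_setN. Qed.

Lemma mx_inB m n (X Y : 'M[R]_(m, n)) : mx_in I X -> mx_in I Y ->
  mx_in I (X - Y).
Proof. by move=> hX hY; apply: mx_inD => //; apply: mx_inN. Qed.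

Lemma mx_in0 m n : mx_in I (0 : 'M[R]_(m, n)).
Proof. by move=> i j; rewrite mxE; case: iI. Qed.

Lemma mx_inMl m n p (X : 'M[R]_(m, n)) (Y : 'M[R]_(n, p)) :
  mx_in I Y -> mx_in I (X *m Y).
Proof.
by move=> hY i j; rewrite mxE; apply: ideal_set_sum => // k; apply: ideal_setM.
Qed.

Lemma mx_inMr m n p (X : 'M[R]_(m, n)) (Y : 'M[R]_(n, p)) :
  mx_in I X -> mx_in I (X *m Y).
Proof.
by move=> hX i j; rewrite mxE; apply: ideal_set_sum => // k; rewrite mulrC;
  apply: ideal_setM.
Qed.

Lemma mx_inZ m n a (X : 'M[R]_(m, n)) : mx_in I X -> mx_in I (a *: X).
Proof. by move=> hX i j; rewrite mxE; apply: ideal_setM. Qed.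

Lemma mx_in_submodule n : submodule (@whole R) (@mx_in R I 1 n).
Proof.
split; first exact: mx_in0.
by move=> a x y _ hx hy; apply: mx_inD => //; apply: mx_inZ.
Qed.

End MxIn.

Section Noetherian.
Variable R : comPzRingType.
Hypothesis noethR : noetherian R.
Local Notation whole := (@whole R).

Lemma split_extension n1 n2 (L : 'rV[R]_(n1 + n2) -> Prop) :
  submodule whole L ->
  extension whole (fun x => L (row_mx x 0)) (fun y => exists x, L
    (row_mx x y)) L.
Proof. by []. Qed.

Lemma split_submodules n1 n2 (L : 'rV[R]_(n1 + n2) -> Prop) :
  submodule whole L ->
  submodule whole (fun x => L (row_mx x 0)) /\
  submodule whole (fun y => exists x, L (row_mx x y)).
Proof.
move=> [L0 h]; split.
  split=> [|a x y _ hx hy]; first by rewrite row_mx0.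
  have -> : row_mx (a *: x + y) 0 =
    a *: row_mx x 0 + row_mx y 0 :> 'rV[R]_(n1 + n2).
    by rewrite scale_row_mx add_row_mx scaler0 addr0.
  exact: h.
split=> [|a y y' _ [x hx] [x' hx']]; first by exists 0; rewrite row_mx0.
by exists (a *: x + x'); rewrite -add_row_mx -scale_row_mx; apply: h.
Qed.

(** Induction on n: the kernel of the last coordinate and its image, an ideal,
    are finitely generated. *)
Lemma noether_span n (L : 'rV[R]_n -> Prop) : submodule whole L ->
  exists k (G : 'M_(k, n)), forall w, L w <-> row_span whole G w.
Proof.
elim: n L => [|n IHn] L sL.
  exists 0%N, 0 => w; have -> : w = 0 by apply/matrixP=> i [].
  by case: (span_submodule whole (0 : 'M[R]_(0, 0))) sL => h _ [].
move: L sL; rewrite -[n.+1]addn1 => L sL.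
have [s1 s2] := split_submodules sL.
have [k1 [G1 h1]] := IHn _ s1.
pose I (a : R) := exists x, L (row_mx x a%:M).
have iI : ideal_set I.
  split; first by have [x hx] := s2.1; exists x; rewrite raddf0.
  move=> a u v hu hv; have := s2.2 a _ _ isT hu hv.
  by rewrite scale_scalar_mx -raddfD.
have [d [z hz]] := noether_fg noethR iI.
have h2 w : (exists x, L (row_mx x w)) <-> row_span whole (\col_i z i) w.
  rewrite [w]mx11_scalar -/(I (w 0 0)) hz; split.
    move=> [c ->]; exists (\row_i c i); first exact: over_whole.
    apply/matrixP => i j; rewrite !ord1 !mxE eqxx mulr1n.
    by apply: eq_bigr => l _; rewrite !mxE.
  move=> [u _ /(congr1 (fun X : 'M_1 => X 0 0))];
    rewrite !mxE eqxx mulr1n => ->.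
  by exists (u 0); apply: eq_bigr => l _; rewrite !mxE.
have eL := split_extension sL.
have [X hX] := extension_lift eL h2.
by exists (k1 + d)%N, (block_mx G1 0 X (\col_i z i));
  apply: (extension_span eL h1 h2 hX).
Qed.

Lemma noether_kernel (I : R -> Prop) m n (D : 'M[R]_(m, n)) : ideal_set I ->
  exists k (K : 'M_(k, m)), forall u, mx_in I (u *m D) <-> row_span whole K u.
Proof.
move=> iI; apply: (noether_span (L := fun u => mx_in I (u *m D))); split.
  by rewrite mul0mx; apply: mx_in0.
move=> a x y _ hx hy; rewrite mulmxDl -scalemxAl.
by apply: mx_inD => //; apply: mx_inZ.
Qed.

End Noetherian.

Definition adjoin (R : comPzRingType) (I : R -> Prop) x a :=
  exists i r, I i /\ a = i + r * x.

Lemma adjoin_ideal (R : comPzRingType) (I : R -> Prop) x : ideal_set I ->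
  ideal_set (adjoin I x).
Proof.
move=> [I0 h]; split; first by exists 0, 0; rewrite mul0r addr0.
move=> a u v [i [r [hi ->]]] [j [t [hj ->]]]; exists (a * i + j), (a * r + t).
by split; [exact: h | ring].
Qed.

Lemma mx_in_adjoin (R : comPzRingType) (I : R -> Prop) x m n
  (X : 'M[R]_(m, n)) :
  mx_in (adjoin I x) X <-> exists Y, mx_in I (X - x *: Y).
Proof.
split=> [h|[Y h] i j]; last first.
  exists (X i j - x * Y i j), (Y i j); split; first by have := h i j;
    rewrite !mxE.
  by rewrite [Y i j * x]mulrC subrK.
have h' i j : {r | I (X i j - x * r)}.
  apply: cid; have [a [r [Ia ->]]] := h i j; exists r.
  by rewrite [x * r]mulrC addrK.
exists (\matrix_(i, j) sval (h' i j)) => i j; rewrite !mxE.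
exact: svalP (h' i j).
Qed.

Section Local.
Variables (R : comPzRingType) (M : R -> Prop).
Hypotheses (noethR : noetherian R) (pM : prime_set M).
Hypothesis unitM : forall a, ~ M a -> invertible a.
Local Notation whole := (@whole R).

Lemma prime_local P : prime_set P -> forall a, P a -> M a.
Proof.
move=> [iP P1 _] a Pa; apply: contrapT => /unitM/asboolP[b [ba _]].
by apply: P1; rewrite -ba; apply: ideal_setM.
Qed.

Lemma local_nakayama x n (L S : 'rV[R]_n -> Prop) : M x ->
  submodule whole L -> submodule whole S ->
  (forall l, L l -> exists2 l', L l' & S (l - x *: l')) ->
  forall l, L l -> S l.
Proof.
move=> Mx sL sS h; have [k [G hG]] := noether_span noethR sL.
have [|c cM hc] := nakayama (G := G) pM Mx sS.
  move=> i; have [|l' /hG[u _ ->] hl'] := h (row i G); first exact/hG/span_row.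
  exists 1, u; split; first by case: pM.
  by rewrite scale1r.
have [b [bc _]] := asboolW (unitM cM).
move=> l /hG[u uB ->]; apply: (submodule_mul sS _ uB) => i.
rewrite -[row i G]scale1r -bc -scalerA; exact: (submoduleZ sS _ (hc i)).
Qed.

Section Lifting.
Variables (I : R -> Prop) (x : R).
Hypotheses (iI : ideal_set I) (Mx : M x) (regx : forall a, I (x * a) -> I a).

Lemma mx_in_reg m n (X : 'M[R]_(m, n)) : mx_in I (x *: X) -> mx_in I X.
Proof. by move=> h i j; apply: regx; have := h i j; rewrite mxE. Qed.

(** x is regular on the cokernel of D modulo I, as happens when this cokernel
    embeds into a free module over the quotient by I. *)
Definition saturated m n (D : 'M[R]_(m, n)) := forall z u,
  mx_in I (x *: z - u *m D) -> exists v : 'rV_m, mx_in I (z - v *m D).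

(** Since x is regular modulo I and on the module presented by D', the kernel of
    D' reduces modulo x onto the kernel of the reduction, so generators of the
    latter lift; by Nakayama's lemma the lifts generate.  The kernel is again
    saturated, so the resolution lifts step by step. *)
Lemma finite_res_lift m n (D : 'M[R]_(m, n)) : finite_res whole
  (adjoin I x) D ->
  forall D', mx_in (adjoin I x) (D - D') -> saturated D' ->
    finite_res whole I D'.
Proof.
have iJ := adjoin_ideal x iI.
have IJ p q (X : 'M[R]_(p, q)) : mx_in I X -> mx_in (adjoin I x) X.
  by move=> h; apply/mx_in_adjoin; exists 0; rewrite ?scaler0 ?subr0.
have ker_sub p q (D' : 'M[R]_(p, q)) : submodule whole
  (fun u => mx_in I (u *m D')).
  split; first by rewrite mul0mx; apply: mx_in0.
  move=> a u v _ hu hv; rewrite mulmxDl -scalemxAl.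
  by apply: mx_inD => //; apply: mx_inZ.
elim=> {m n D} [m n D injD|m n k D K _ kerD _ IHK] D' DD' satD'.
  apply: finite_res_inj => u _;
    apply: (local_nakayama Mx (ker_sub _ _ D') (mx_in_submodule iI _)).
  move=> {}u hu; have : mx_in (adjoin I x) u.
    apply: injD; first exact: over_whole.
    rewrite -[D](subrK D') mulmxDr; apply: mx_inD => //; last exact: IJ.
    exact: mx_inMl.
  case/mx_in_adjoin => y hy; exists y => //; apply: mx_in_reg.
  rewrite scalemxAl -(subKr u (x *: y)) mulmxBl; apply: mx_inB => //.
  exact: mx_inMr.
have liftK i : {w : 'rV_m | mx_in I ((row i K - x *: w) *m D')}.
  apply: cid; have : mx_in (adjoin I x) (row i K *m D).
    apply/kerD; first exact: over_whole.
    exists (delta_mx 0 i); first exact: over_whole.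
    by rewrite -rowE subrr; apply: mx_in0.
  move=> hi; have : mx_in (adjoin I x) (row i K *m D').
    rewrite -[D'](subKr D) mulmxBr; apply: mx_inB => //; exact: mx_inMl.
  case/mx_in_adjoin => z hz; have [|v hv] := satD' z (row i K).
    by rewrite -opprB; apply: mx_inN.
  exists v; rewrite mulmxBl -scalemxAl -(subrK (x *: z) (row i K *m D')).
  by rewrite -addrA -scalerBr; apply: mx_inD => //; apply: mx_inZ.
pose K' := K - x *: \matrix_i sval (liftK i).
have rowK' i : row i K' = row i K - x *: sval (liftK i).
  by apply/rowP => j; rewrite !mxE.
have K'D' : mx_in I (K' *m D').
  move=> i j; have := svalP (liftK i) 0 j.
  rewrite -(_ : row i (K' *m D') 0 j = (K' *m D') i j); last by rewrite mxE.
  by rewrite row_mul rowK'.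
have KK' : mx_in (adjoin I x) (K - K').
  apply/mx_in_adjoin; exists (\matrix_i sval (liftK i)).
  by rewrite /K' subKr subrr; apply: mx_in0.
have iS : submodule whole (fun u => exists v, mx_in I (u - v *m K')).
  split; first by exists 0; rewrite mul0mx subrr; apply: mx_in0.
  move=> a u v _ [u' hu] [v' hv]; exists (a *: u' + v').
  rewrite mulmxDl -scalemxAl opprD addrACA -scalerBr.
  by apply: mx_inD => //; apply: mx_inZ.
have kerK' (u : 'rV_m) : mx_in I (u *m D') <-> exists v : 'rV_k, mx_in I
  (u - v *m K').
  split=> [|[v hv]]; last first.
    rewrite -(subrK (v *m K') u) mulmxDl -mulmxA.
    by apply: mx_inD => //; [apply: mx_inMr | apply: mx_inMl].
  move: u; apply: (local_nakayama Mx (ker_sub _ _ D') iS) => u hu.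
  have /kerD[] : mx_in (adjoin I x) (u *m D); rewrite ?over_whole //.
    rewrite -[D](subrK D') mulmxDr; apply: mx_inD => //; last exact: IJ.
    exact: mx_inMl.
  move=> v _ hv; have : mx_in (adjoin I x) (u - v *m K').
    rewrite -[K'](subKr K) mulmxBr opprB addrCA addrC.
    by apply: mx_inD => //; apply: mx_inMl.
  case/mx_in_adjoin => y hy; exists y; last by exists v; rewrite addrAC.
  apply: mx_in_reg; rewrite scalemxAl -(subKr (u - v *m K') (x *: y)) !mulmxBl.
  apply: mx_inB => //; last by rewrite -!mulmxBl; apply: mx_inMr.
  by apply: mx_inB => //; rewrite -mulmxA; apply: mx_inMl.
apply: (finite_res_step (K := K')) (IHK _ KK' _); first exact: over_whole.
  move=> u _; rewrite kerK'; split=> [[v hv]|[v _ hv]]; exists v => //.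
  exact: over_whole.
move=> z u hz; apply/kerK'/mx_in_reg.
rewrite scalemxAl -(subrK (u *m K') (x *: z)) mulmxDl -mulmxA.
by apply: mx_inD => //; [apply: mx_inMr | apply: mx_inMl].
Qed.
End Lifting.

(** Modulo M this is the existence of a basis of a subspace. *)
Lemma residue_basis n (L : 'rV[R]_n -> Prop) :
  submodule whole L -> (forall w, mx_in M w -> L w) ->
  exists k (K : 'M_(k, n)),
    (forall w, L w <-> exists v : 'rV_k, mx_in M (w - v *m K)) /\
    (forall v : 'rV_k, mx_in M (v *m K) -> mx_in M v).
Proof.
have iM : ideal_set M by case: pM.
elim: n L => [|n IHn] L sL ML.
  exists 0%N, 0; split=> [w|v _ i []//].
  by split=> [_|_]; [exists 0 => i [] | apply: ML => i []].
move: L sL ML; rewrite -[n.+1]addn1 => L sL ML.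
have [s1 _] := split_submodules sL.
have [|k1 [K1 [h1 inj1]]] := IHn _ s1.
  move=> w hw; apply: ML => i j.
  by case: (split_ordP j) => l ->; rewrite ?row_mxEl ?row_mxEr ?mxE //;
    case: iM.
have mxl p (w : 'M[R]_(p, n + 1)) : mx_in M w -> mx_in M (lsubmx w).
  by move=> h i j; rewrite mxE.
have mxr p (w : 'M[R]_(p, n + 1)) : mx_in M w -> mx_in M (rsubmx w).
  by move=> h i j; rewrite mxE.
have mxlr p q (u : 'M[R]_(p, q)) (w : 'M[R]_(p, 1)) :
    mx_in M u -> mx_in M w -> mx_in M (row_mx u w).
  by move=> hu hw i j; case: (split_ordP j) => l ->;
    rewrite ?row_mxEl ?row_mxEr.
have [[x0 L0]|nL] := pselect (exists x, L (row_mx x 1%:M)).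
  exists (k1 + 1)%N, (block_mx K1 0 x0 1%:M).
  split=> [w|v].
    have cL c : L (c *m row_mx x0 1%:M).
      by apply: submodule_mul (over_whole _) => // i; rewrite ord1 row_id.
    rewrite -[w]hsubmxK; move: (lsubmx w) (rsubmx w) => {w} u c.
    split=> [Lw|[v]].
      have /h1[v hv] : L (row_mx (u - c *m x0) 0).
        have := submoduleB sL Lw (cL c).
        by rewrite mul_mx_row opp_row_mx add_row_mx mulmx1 subrr.
      exists (row_mx v c).
      rewrite mul_row_block mulmx0 add0r mulmx1 opp_row_mx add_row_mx subrr.
      apply: mxlr; last exact: mx_in0.
      by rewrite opprD addrA addrAC.
    rewrite -[v]hsubmxK mul_row_block mulmx0 add0r mulmx1 => hv.
    rewrite -[row_mx u c](subrK
      (row_mx (lsubmx v *m K1 + rsubmx v *m x0) (rsubmx v))).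
    apply: (submoduleD sL); first exact: ML.
    rewrite -[X in row_mx _ X]add0r -add_row_mx; apply: (submoduleD sL).
      by apply/h1; exists (lsubmx v); rewrite subrr; apply: mx_in0.
    by have := cL (rsubmx v); rewrite mul_mx_row mulmx1.
  rewrite -[v]hsubmxK mul_row_block mulmx0 add0r mulmx1 => hv.
  have := mxl _ _ hv; have := mxr _ _ hv; rewrite row_mxKl row_mxKr => h2 h.
  apply: mxlr => //; apply: inj1; rewrite -(addrK (rsubmx v *m x0) (_ *m K1)).
  by apply: mx_inB => //; apply: mx_inMr.
have LM w : L w -> mx_in M (rsubmx w).
  move=> Lw i j; rewrite !ord1; apply: contrapT => /unitM/asboolP[b [bc _]].
  apply: nL; exists (b *: lsubmx w).
  have -> : 1%:M =
    b *: rsubmx w by rewrite [rsubmx w]mx11_scalar scale_scalar_mx bc.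
  by rewrite -scale_row_mx hsubmxK; apply: (submoduleZ sL).
exists k1, (row_mx K1 0); split=> [w|v]; last first.
  by rewrite mul_mx_row => /mxl; rewrite row_mxKl; apply: inj1.
have e (v : 'rV_k1) : w - v *m row_mx K1 0 = row_mx
  (lsubmx w - v *m K1) (rsubmx w).
  by rewrite -{1}[w]hsubmxK mul_mx_row mulmx0 opp_row_mx oppr0 add_row_mx addr0.
split=> [Lw|[v]].
  have /h1[v hv] : L (row_mx (lsubmx w) 0).
    have -> : row_mx (lsubmx w) 0 = w - row_mx 0 (rsubmx w).
      by rewrite -{2}[w]hsubmxK opp_row_mx add_row_mx subr0 subrr.
    apply: (submoduleB sL Lw); apply: ML; apply: mxlr;
      [exact: mx_in0 | exact: LM].
  by exists v; rewrite e; apply: mxlr => //; apply: LM.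
rewrite e => hv; rewrite -[w](subrK (v *m row_mx K1 0)).
apply: (submoduleD sL); first by rewrite e; apply: ML.
rewrite mul_mx_row mulmx0; apply/h1; exists v; rewrite subrr; exact: mx_in0.
Qed.

Lemma finite_res_residue m n (D : 'M[R]_(m, n)) : finite_res whole M D.
Proof.
have iM : ideal_set M by case: pM.
have [||k [K [kerK injK]]] := @residue_basis m (fun u => mx_in M (u *m D)).
- split; first by rewrite mul0mx; apply: mx_in0.
  move=> a u v _ hu hv; rewrite mulmxDl -scalemxAl.
  by apply: mx_inD => //; apply: mx_inZ.
- by move=> w; apply: mx_inMr.
apply: (finite_res_step (K := K)); first exact: over_whole.
  move=> u _; rewrite kerK; split=> [[v hv]|[v _ hv]]; exists v => //.
  exact: over_whole.
by apply: finite_res_inj => v _; apply: injK.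
Qed.

(** Chains are recorded by their bottom P because the inductions below remove the
    bottom prime. *)
Fixpoint chain l (P : R -> Prop) : Prop := prime_set P /\
  if l is l'.+1 then exists2 P', strict P P' & chain l' P' else True.

Lemma chain_prime l P : chain l P -> prime_set P.
Proof. by case: l => [|l] []. Qed.

(** Going down from the top of the chain, each prime is exchanged for one that
    contains x. *)
Lemma chain_shift l P x : M x -> chain l.+1 P ->
  exists P1, [/\ strict P P1, P1 x & chain l P1].
Proof.
move=> Mx; elim: l P => [|l IHl] P [pP [P' sP cP']].
  exists M; split=> //; have PM := prime_local cP'.1.
  case: sP => PP' [a P'a nPa]; split; first by move=> b /PP'/PM.
  by exists a => //; apply: PM.
have [P'' [sP' P''x cP'']] := IHl _ cP'.
have [Q [pQ sPQ sQ Qx]] := intermediate_prime noethR pP cP'.1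
  (chain_prime cP'') sP sP' P''x.
by exists Q; split=> //; split=> //; exists P''.
Qed.

Definition generated e (I : R -> Prop) (x : 'I_e -> R) a :=
  exists i (c : 'I_e -> R), I i /\ a = i + \sum_j c j * x j.

Lemma generated_recl e (I : R -> Prop) (x : 'I_e.+1 -> R) a : generated I x a ->
  generated (adjoin I (x ord0)) (fun j => x (lift ord0 j)) a.
Proof.
move=> [i [c [Ii ->]]]; exists (i + c ord0 * x ord0),
  (fun j => c (lift ord0 j)).
by split; [exists i, (c ord0) | rewrite big_ord_recl addrA].
Qed.

Lemma adjoin_sub (I P : R -> Prop) x : prime_set P -> (forall a, I a -> P a) ->
  P x ->
  forall a, adjoin I x a -> P a.
Proof.
by move=> [iP _ _] IP Px a [i [r [/IP Pi ->]]]; apply: ideal_setD => //;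
  apply: ideal_setM.
Qed.

(** After a shift, the primes above the smallest one contain one more
    generator. *)
Lemma chain_bound e (I : R -> Prop) (x : 'I_e -> R) : ideal_set I ->
  (forall j, M (x j)) ->
  (forall a, M a -> generated I x a) ->
  forall l P, chain l P -> (forall a, I a -> P a) -> (l <= e)%N.
Proof.
elim: e I x => [|e IHe] I x iI Mx MI [|l] P //.
  move=> [_ [P' [_ [a P'a nPa]] cP']] IP; case: nPa; apply: IP.
  have [i [c [Ii ->]]] := MI a (prime_local (chain_prime cP') P'a).
  by rewrite big_ord0 addr0.
move=> cP IP; have [P1 [[PP1 _] P1x cP1]] := chain_shift (Mx ord0) cP.
have pP1 := chain_prime cP1; rewrite ltnS.
apply: (IHe (adjoin I (x ord0)) (fun j => x (lift ord0 j))) cP1 _ => //.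
- exact: adjoin_ideal.
- by move=> a /MI/generated_recl.
- by apply: adjoin_sub => // a /IP/PP1.
Qed.

(** The quotient by I is regular: the number of generators of its maximal ideal
    is the length of a chain of primes.  Let J be I plus the first generator x.
    Shifting the chain gives P, P1, ... with x in P1, and J = P1 by induction.
    The bound on chains keeps x outside P, so every element of P is congruent
    modulo I to x times an element of P, and P = I by Nakayama's lemma.  Hence x
    is regular modulo I and resolutions lift from J to I. *)
Lemma regular_quotient e (I : R -> Prop) (x : 'I_e -> R) : ideal_set I ->
  (forall j, M (x j)) ->
  (forall a, M a -> generated I x a) ->
  forall P, chain e P -> (forall a, I a -> P a) ->
  (forall a, P a -> I a) /\ forall m n (D : 'M_(m, n)), finite_res whole I D.
Proof.
elim: e I x => [|e IHe] I x iI Mx MI P cP IP.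
  have MI' a : M a -> I a by move=> /MI[i [c [Ii ->]]]; rewrite big_ord0 addr0.
  have PM := prime_local (chain_prime cP).
  split=> [a /PM /MI' //|m n D].
  have -> : I = M by apply/funext=> a; apply/propext; split=> [/IP/PM|/MI'].
  exact: finite_res_residue.
have [P1 [[PP1 _] P1x cP1]] := chain_shift (Mx ord0) cP.
have pP1 := chain_prime cP1; have pP := chain_prime cP.
have [iP _ prP] := pP.
have MJ a : M a -> generated (adjoin I (x ord0)) (fun j => x (lift ord0 j)) a.
  by move/MI/generated_recl.
have iJ := adjoin_ideal (x ord0) iI.
have JP1 : forall a, adjoin I (x ord0) a -> P1 a.
  by apply: adjoin_sub => // a /IP/PP1.
have [P1J ffrJ] := IHe _ (fun j => x (lift ord0 j)) iJ
  (fun j => Mx _) MJ _ cP1 JP1.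
have nPx : ~ P (x ord0).
  move=> Px; have := chain_bound iJ (fun j => Mx _) MJ cP (adjoin_sub pP IP Px).
  by rewrite ltnn.
have PI a : P a -> I a.
  move=> Pa; have s1 Q : ideal_set Q -> submodule whole
    (fun w : 'rV[R]_1 => Q (w 0 0)).
    move=> [Q0 hQ]; split; first by rewrite mxE.
    by move=> b u v _ hu hv; rewrite !mxE; apply: hQ.
  have := local_nakayama (Mx ord0) (s1 _ iP) (s1 _ iI) _ (l := a%:M).
  rewrite mxE mulr1n; apply=> // l /[dup] Pl /PP1/P1J[i [r [Ii e1]]].
  exists r%:M; last by rewrite !mxE mulr1n e1 mulrC addrK.
  rewrite mxE mulr1n; have [//|/nPx//] : P r \/ P (x ord0).
  by apply: prP; apply: ideal_setDr iP (IP _ Ii) _; rewrite addrC -e1.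
split=> // m n D; have [k [K hK]] := noether_kernel noethR D iI.
apply: (finite_res_step (K := K)); first exact: over_whole.
  move=> u _; rewrite hK; split=> [[v vB ->]|[v vB huv]].
    by exists v => //; rewrite subrr; apply: mx_in0.
  apply/hK; rewrite -(subrK (v *m K) u) mulmxDl; apply: mx_inD => //.
    exact: mx_inMr.
  by apply/hK; exists v.
have regx a : I (x ord0 * a) -> I a.
  by move/IP/prP => [/nPx|/PI].
apply: (finite_res_lift iI (Mx ord0) regx (ffrJ _ _ K)).
  by rewrite subrr; apply: mx_in0.
move=> z u hz; have /hK[v vB ev] : mx_in I (z *m D).
  apply: (mx_in_reg regx); rewrite scalemxAl -(subrK (u *m K) (_ *: z)) mulmxDl.
  apply: mx_inD => //; first exact: mx_inMr.
  by apply/hK; exists u => //; apply: over_whole.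
by exists v; rewrite ev subrr; apply: mx_in0.
Qed.

End Local.

Section RegularLocal.
Variable R : comPzRingType.
Local Notation whole := (@whole R).

Lemma local_unit (M : {pred R}) a : noetherian R -> local_ring_at M ->
  a \notin M -> invertible a.
Proof.
move=> noethR [_ uM] aM; apply: contrapT => na.
pose F J := [/\ ideal_set J, ~ J 1 & J a].
have [||J [iJ J1 Ja] maxJ] := noether_max noethR
  (F := F) (I0 := fun y => exists r, y = r * a).
- by move=> J [].
- split; last by exists 1; rewrite mul1r.
    split; first by exists 0; rewrite mul0r.
    by move=> b _ _ [r ->] [t ->]; exists (b * r + t); rewrite mulrDl mulrA.
  by move=> [r e]; apply: na; apply/asboolP; exists r; rewrite -e mulrC -e.
have mJ : maximal_ideal [pred y | `[< J y >]].
  split.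
  - split; first by apply/asboolP; case: iJ.
    by move=> b u v /asboolP hu /asboolP hv; apply/asboolP/iJ.2.
  - by apply/negP => /asboolP.
  - move=> J' iJ' J'1 JJ' y; apply/idP/idP; last exact: JJ'.
    move=> J'y; apply/asboolP; apply: (maxJ (fun y => y \in J')) => //.
      split; first by case: iJ' => ? h; split=> // b u v; apply: h.
        exact/negP.
      by apply: JJ'; apply/asboolP.
    by move=> b Jb; apply: JJ'; apply/asboolP.
by case/negP: aM; rewrite -(uM _ mJ); apply/asboolP.
Qed.

Lemma local_prime (M : {pred R}) : noetherian R -> local_ring_at M ->
  prime_ideal M.
Proof.
move=> noethR lM; have [[iM M1 _] _] := lM; split=> // u v uvM.
apply/orP; case: (boolP (u \in M)) => [|/(local_unit noethR lM)]; first by left.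
move=> /asboolP[w [wu _]]; right; rewrite -[v]mul1r -wu -mulrA -[_ * _]addr0.
by case: iM => M0 h; apply: h.
Qed.

Lemma chain_of d (p : 'I_d.+1 -> {pred R}) : prime_chain p ->
  forall l (i : 'I_d.+1), (i + l)%N = d -> chain l (fun a => a \in p i).
Proof.
move=> [pp sp]; elim=> [|l IHl] i e; first by split=> //; apply: prime_set_of.
split; first exact: prime_set_of.
have lti : (i.+1 < d.+1)%N by have := leq_addr l i.+1; rewrite addSnnS e ltnS.
exists (fun a => a \in p (Ordinal lti)); last by apply: IHl; rewrite /= addSnnS.
have [h1 h2] := sp i (Ordinal lti) (ltnSn i); split=> //.
apply: contrapT => h; apply: h2 => a ha; apply: contrapT => nha; apply: h.
by exists a.
Qed.

Lemma regular_local_finite_res : regular_local R ->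
  [/\ (1 : R) <> 0, forall a b : R, a * b = 0 -> a = 0 \/ b = 0
    & forall m n (D : 'M[R]_(m, n)), finite_res whole (fun a => a = 0) D].
Proof.
move=> [noethR [M [lM [d [[[p cp] _] [x gx]]]]]].
have pM := prime_set_of (local_prime noethR lM).
have uM a : ~ (a \in M) -> invertible a by move=> /negP; apply: local_unit.
have i0 : ideal_set (fun a : R => a = 0).
  by split=> // a u v -> ->; rewrite mulr0 addr0.
have c0 := chain_of cp (i := ord0) (add0n d).
have [iP P1 prP] := chain_prime c0.
have [|||P0 fD] := regular_quotient noethR pM uM i0 (x := x) _ _ c0 _.
- move=> j; apply/gx; exists (fun k => (j == k)%:R).
  rewrite (bigD1 j) //= eqxx mul1r big1 ?addr0 // => k /negPf kj.
  by rewrite eq_sym kj mul0r.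
- by move=> a /gx[c ->]; exists 0, c; rewrite add0r.
- by move=> a ->; case: iP.
split=> // [e|a b ab]; first by apply: P1; rewrite e; case: iP.
by have [/P0|/P0] : a \in p ord0 \/ b \in p ord0;
  [apply: prP; rewrite ab; case: iP | left | right].
Qed.

End RegularLocal.

(** * Localizations and quotients *)

Section Canonical.
Variables (R : comPzRingType) (S : mulrClosed R).

Definition to_loc (a : R) : localization S := Defs.frac a (denom1 S).

Lemma to_loc_zmod : zmod_morphism to_loc.
Proof.
move=> a b; apply: esym; rewrite /to_loc -[LHS]/(loc_add _ (loc_opp _)).
rewrite loc_oppE loc_addE.
by apply/frac_eqP; exists 1; rewrite ?rpred1 //=; ring.
Qed.

Lemma to_loc_monoid : monoid_morphism to_loc.
Proof.
split=> // a b; apply: esym; rewrite -[LHS]/(loc_mul _ _) loc_mulE.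
by apply/frac_eqP; exists 1; rewrite ?rpred1 //=; ring.
Qed.

HB.instance Definition _ :=
  GRing.isZmodMorphism.Build R (localization S) to_loc to_loc_zmod.
HB.instance Definition _ :=
  GRing.isMonoidMorphism.Build R (localization S) to_loc to_loc_monoid.

Lemma to_loc_frac a (s : denom S) : to_loc (val s) * Defs.frac a s = to_loc a.
Proof.
rewrite -[LHS]/(loc_mul _ _) loc_mulE.
by apply/frac_eqP; exists 1; rewrite ?rpred1 //=; ring.
Qed.

Lemma to_loc_eq0 a : to_loc a = 0 -> exists2 w, w \in S & w * a = 0.
Proof.
move=> /frac_eqP[w Sw /= e]; exists w => //.
by move: e; rewrite mulr1 mul0r mulr0.
Qed.

Lemma to_loc_unit s : s \in S -> invertible (to_loc s).
Proof.
move=> Ss; have e := to_loc_frac 1 (Sub s Ss : denom S).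
apply/asboolP; exists (Defs.frac 1 (Sub s Ss)).
have e1 : to_loc s * Defs.frac 1 (Sub s Ss) = 1 by rewrite e /to_loc.
by rewrite mulrC e1.
Qed.

End Canonical.

Section QuotientMap.
Variables (R : comPzRingType) (t : R).

Definition to_quot (a : R) : quot_by t := \pi a.

Lemma to_quot_zmod : zmod_morphism to_quot.
Proof.
move=> a b; apply: (addIr (to_quot b)); rewrite subrK.
by rewrite /to_quot quot_addE subrK.
Qed.

Lemma to_quot_monoid : monoid_morphism to_quot.
Proof. by split=> // a b; rewrite -[RHS]/(quot_mul _ _) quot_mulE. Qed.

HB.instance Definition _ :=
  GRing.isZmodMorphism.Build R (quot_by t) to_quot to_quot_zmod.
HB.instance Definition _ :=
  GRing.isMonoidMorphism.Build R (quot_by t) to_quot to_quot_monoid.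

Lemma to_quot_eq0 a : to_quot a = 0 -> exists c, a = c * t.
Proof.
have -> : 0 = to_quot 0 by rewrite rmorph0.
by move/quot_eqP; rewrite subr0.
Qed.

End QuotientMap.

Definition multiple_of (R : comPzRingType) (t a : R) := exists b, a = b * t.

(** Resolutions over a quotient of A are resolutions over A modulo the
    kernel. *)
Section Transport.
Variables (A R : comPzRingType) (phi : {rmorphism A -> R}) (t : A).
Hypothesis phi_surj : forall y, exists a, phi a = y.
Hypothesis phi_ker : forall a, phi a = 0 <-> multiple_of t a.

Lemma map_mx_surj m n (Y : 'M[R]_(m, n)) : exists X, map_mx phi X = Y.
Proof.
have h i j : {a | phi a = Y i j} by apply: cid.
exists (\matrix_(i, j) sval (h i j)); apply/matrixP => i j.
by rewrite !mxE (svalP (h i j)).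
Qed.

Lemma map_mx_ker m n (X : 'M[A]_(m, n)) :
  mx_in (multiple_of t) X <-> mx_in (fun y => y = 0) (map_mx phi X).
Proof.
by split=> h i j; have := h i j; rewrite mxE phi_ker.
Qed.

Lemma finite_res_transport m n (D' : 'M[R]_(m, n)) :
  finite_res (@whole R) (fun y => y = 0) D' ->
  forall D, map_mx phi D = D' -> finite_res (@whole A) (multiple_of t) D.
Proof.
elim=> {m n D'} [m n D' injD|m n k D' K' _ kerD _ IHK] D eD.
  apply: finite_res_inj => u _ /map_mx_ker; rewrite map_mxM eD => h.
  by apply/map_mx_ker/injD => //; apply: over_whole.
have [K eK] := map_mx_surj K'.
apply: (finite_res_step (K := K)) (IHK _ eK); first exact: over_whole.
move=> u _; rewrite map_mx_ker map_mxM eD kerD ?over_whole //.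
split=> [[v' _ h]|[v _ /map_mx_ker h]].
  have [v ev] := map_mx_surj v'; exists v; first exact: over_whole.
  by apply/map_mx_ker; rewrite map_mxB map_mxM eK ev.
exists (map_mx phi v); first exact: over_whole.
by move: h; rewrite map_mxB map_mxM eK.
Qed.

End Transport.

Section RegularQuotient.
Variables (A : comPzRingType) (M : {pred A}).
Hypotheses (noethA : noetherian A) (localA : local_ring_at M).

(** When t is not a unit, the quotient by t is local, so it is its own
    localization at the maximal ideal, which is regular local by hypothesis. *)
Lemma finite_res_regular_quotient (t : A) m n (D : 'M[A]_(m, n)) :
  regular_ring (quot_by t) -> finite_res (@whole A) (multiple_of t) D.
Proof.
move=> [_ rQ]; have [tM|tM] := boolP (t \in M); last first.
  have /asboolP[t' [t't _]] := local_unit noethA localA tM.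
  by apply: finite_res_inj => u _ _ i j; exists (u i j * t');
    rewrite -mulrA t't mulr1.
have pM := local_prime noethA localA; have [[iM M1 prM] _] := (pM, tt).
have pSM := prime_set_of pM; have [iSM _ _] := pSM.
pose P : {pred quot_by t} :=
  fun y => `[< exists2 a, a \in M & to_quot t a = y >].
have inP a : (to_quot t a \in P) = (a \in M).
  apply/asboolP/idP => [[b bM /eqP]|aM]; last by exists a.
  rewrite -subr_eq0 -rmorphB => /eqP/to_quot_eq0[c e].
  rewrite -(subKr b a); apply: (ideal_setB iSM) => //; rewrite e.
  exact: (ideal_setM c iSM).
have qsurj (y : quot_by t) : exists a, to_quot t a = y.
  by elim/quot_W: y => a; exists a.
have pP : prime_ideal P.
  split.
  - split; first by rewrite -(rmorph0 (to_quot t)) inP; case: iM.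
    move=> y u v; have [a <-] := qsurj y; have [b <-] := qsurj u.
    have [c <-] := qsurj v.
    by rewrite -rmorphM -rmorphD !inP; apply: iM.2.
  - by rewrite -(rmorph1 (to_quot t)) inP.
  - move=> u v; have [b <-] := qsurj u; have [c <-] := qsurj v.
    by rewrite -rmorphM !inP; apply: prM.
have [_ _ fL] := regular_local_finite_res (rQ P pP).
have unitP (y : quot_by t) : y \notin P -> invertible y.
  have [a <-] := qsurj y;
    rewrite inP => /(local_unit noethA localA)/asboolP[b [ba ab]].
  by apply/asboolP; exists (to_quot t b); rewrite -!rmorphM ba ab rmorph1.
pose S := HB.pack_for (mulrClosed (quot_by t)) (outside P)
    (GRing.isMulClosed.Build (quot_by t) (outside P) (outside_mulr_closed pP)).
pose phi : {rmorphism A -> localization S} := @to_loc _ S \o to_quot t.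
apply: (finite_res_transport (phi := phi)) (fL m n (map_mx phi D)) _ erefl.
- elim/fracW => y s; have [a ea] := qsurj y.
  have /asboolP[z [zs sz]] := unitP _ (valP s).
  have [b eb] := qsurj z; exists (a * b).
  rewrite /phi /= rmorphM /= ea eb rmorphM /= -(to_loc_frac y s) mulrC mulrA.
  by rewrite -rmorphM zs rmorph1 mul1r.
- move=> a; split=> [/to_loc_eq0[w /unitP/asboolP[z [zw _]] e]|[b ->]].
    by apply: to_quot_eq0; rewrite -[LHS]mul1r -zw -mulrA e mulr0.
  rewrite /phi /= [to_quot t _](_ : _ = 0) ?rmorph0 //.
  rewrite -(rmorph0 (to_quot t)); apply/quot_eqP.
  by exists b; rewrite subr0.
Qed.

End RegularQuotient.

(** * Inverting the elements one at a time *)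

Section Subrings.
Variables (A C : comPzRingType) (iota : {rmorphism A -> C}).
Hypothesis iota_inj : injective iota.

(** The subring A[1/f] of C. *)
Definition away_sub (f : A) : {pred C} :=
  fun c => `[< exists k a, iota f ^+ k * c = iota a >].

Lemma away_sub_closed f : subring_closed (away_sub f).
Proof.
split.
- by apply/asboolP; exists 0%N, 1; rewrite mul1r rmorph1.
- move=> c d /asboolP[k [a e]] /asboolP[l [b e']]; apply/asboolP.
  exists (k + l)%N, (f ^+ l * a - f ^+ k * b).
  by rewrite rmorphB !rmorphM !rmorphXn -e -e' exprD; ring.
- move=> c d /asboolP[k [a e]] /asboolP[l [b e']]; apply/asboolP.
  exists (k + l)%N, (a * b).
  by rewrite rmorphM -e -e' exprD; ring.
Qed.

HB.instance Definition _ f :=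
  GRing.isSubringClosed.Build C (away_sub f) (away_sub_closed f).

Lemma clear_denominators f m n (X : 'M[C]_(m, n)) :
  X \is a mxOver (away_sub f) ->
  exists k X0, iota f ^+ k *: X = map_mx iota X0.
Proof.
move=> /mxOverP XB.
have h (p : 'I_m * 'I_n) :
  {ka : nat * A | iota f ^+ ka.1 * X p.1 p.2 = iota ka.2}.
  by apply: cid; have [k [a e]] := asboolW (XB p.1 p.2); exists (k, a).
pose k := \max_p (sval (h p)).1.
exists k, (\matrix_(i, j) (f ^+ (k - (sval (h (i, j))).1) *
  (sval (h (i, j))).2)).
apply/matrixP => i j; rewrite !mxE rmorphM rmorphXn.
rewrite -(svalP (h (i, j))) mulrA -exprD subnK //.
exact: (leq_bigmax (i, j)).
Qed.

Lemma over_away f k m n (X : 'M[C]_(m, n)) X0 :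
  iota f ^+ k *: X = map_mx iota X0 -> X \is a mxOver (away_sub f).
Proof.
move=> /matrixP e; apply/mxOverP => i j; apply/asboolP; exists k, (X0 i j).
by have := e i j; rewrite !mxE.
Qed.

Lemma over_map f m n (X0 : 'M[A]_(m, n)) : map_mx iota X0 \is a mxOver
  (away_sub f).
Proof. by apply: (@over_away _ 0%N _ _ _ X0); rewrite scale1r. Qed.

Lemma scale_pow_inj f k m n (X Y : 'M[C]_(m, n)) : invertible (iota f) ->
  iota f ^+ k *: X = iota f ^+ k *: Y -> X = Y.
Proof.
move=> /asboolP[g [gf _]] e.
have gk : g ^+ k * iota f ^+ k = 1.
  by rewrite -exprMn_comm ?gf ?expr1n //; apply: mulrC.
by rewrite -[X]scale1r -[Y]scale1r -gk -!scalerA e.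
Qed.

Lemma divide_pow f k m n (X0 : 'M[A]_(m, n)) : invertible (iota f) ->
  exists2 X, X \is a mxOver (away_sub f) & iota f ^+ k *: X = map_mx iota X0.
Proof.
move=> /asboolP[g [gf fg]].
have fk : iota f ^+ k * g ^+ k = 1.
  by rewrite -exprMn_comm ?fg ?expr1n //; apply: mulrC.
have e : iota f ^+ k *: (g ^+ k *: map_mx iota X0) = map_mx iota X0.
  by rewrite scalerA fk scale1r.
by exists (g ^+ k *: map_mx iota X0) => //; apply: over_away e.
Qed.

Lemma map_mx_iota_inj m n : injective (@map_mx A C iota m n).
Proof.
by move=> X Y /matrixP e; apply/matrixP => i j; apply: iota_inj; have := e i j;
  rewrite !mxE.
Qed.

Section OneDenominator.
Variables (f t T : A).
Hypotheses (noethA : noetherian A) (f_unit : invertible (iota f)).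
Hypotheses (T_unit : invertible (iota T)) (T_all : forall c, c \in away_sub T).
Local Notation B := (away_sub f).

(** Here C itself is A[1/T], so denominators can be cleared in D as well as in
    the vectors of its kernel. *)
Lemma kernel_away m n (D : 'M[C]_(m, n)) :
  exists k (K : 'M[C]_(k, m)), K \is a mxOver B /\
    forall u : 'rV_m, u \is a mxOver B -> u *m D = 0 <-> row_span B K u.
Proof.
have [l [D0 eD]] := clear_denominators
  (f := T) (X := D) (introT mxOverP (fun _ _ => T_all _)).
have i0 : ideal_set (fun a : A => a = 0).
  by split=> // a u v -> ->; rewrite mulr0 addr0.
have eq0 p q (X : 'M[A]_(p, q)) : mx_in (fun a => a = 0) X <-> X = 0.
  by split=> [h|-> i j]; [apply/matrixP => i j; rewrite h|]; rewrite mxE.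
have [k [K0 hK]] := noether_kernel noethA D0 i0.
exists k, (map_mx iota K0); split=> [|u uB]; first exact: over_map.
have [j [u0 eu]] := clear_denominators uB.
have eud : iota T ^+ l *: (iota f ^+ j *: (u *m D)) = map_mx iota (u0 *m D0).
  by rewrite map_mxM -eu -eD -scalemxAl -scalemxAr scalerA [_ * iota f ^+
    j]mulrC -scalerA.
split=> [uD|[v vB ->]].
  have /hK[v _ ev] : mx_in (fun a => a = 0) (u0 *m D0).
    by apply/eq0/map_mx_iota_inj; rewrite -eud uD !scaler0 map_mx0.
  have [w wB ew] := divide_pow j v f_unit; exists w => //.
  by apply: (scale_pow_inj (k := j) f_unit);
    rewrite eu ev map_mxM -ew scalemxAl.
have KD : K0 *m D0 = 0.
  apply/row_matrixP => i; rewrite row_mul row0; apply/eq0/hK/span_row.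
suff KDC : map_mx iota K0 *m D = 0 by rewrite -mulmxA KDC mulmx0.
apply: (scale_pow_inj (k := l) T_unit).
by rewrite scalemxAr eD -map_mxM KD map_mx0 scaler0.
Qed.

Local Notation t_multiple := (subring_multiple B (iota t)).

Lemma t_multiple_away k m n (X : 'M[C]_(m, n)) X0 :
  iota f ^+ k *: X = map_mx iota X0 ->
  mx_in (multiple_of t) X0 -> mx_in t_multiple X.
Proof.
move=> e hX0; have h i j : {b | X0 i j = b * t} := cid (hX0 i j).
have [Y YB eY] := divide_pow k (\matrix_(i, j) sval (h i j)) f_unit.
apply/mx_in_subring_multiple; exists Y => //;
  apply: (scale_pow_inj (k := k) f_unit).
rewrite e scalerA mulrC -scalerA eY; apply/matrixP => i j; rewrite !mxE.
by case: (h i j) => b /= ->; rewrite rmorphM mulrC.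
Qed.

Lemma away_t_multiple k m n (X : 'M[C]_(m, n)) X0 :
  iota f ^+ k *: X = map_mx iota X0 ->
  mx_in t_multiple X -> exists j, mx_in (multiple_of t) (f ^+ j *: X0).
Proof.
move=> e /mx_in_subring_multiple[Y /clear_denominators[j [Y0 eY]] eX].
exists j; suff -> : f ^+ j *: X0 = (f ^+ k * t) *: Y0.
  by move=> i l; rewrite mxE; exists (f ^+ k * Y0 i l); ring.
apply: map_mx_iota_inj; rewrite !map_mxZ -e eX rmorphM !rmorphXn /= -eY.
by rewrite !scalerA; congr (_ *: _); ring.
Qed.

(** Localization is exact: after clearing denominators, the membership of u D in
    t B is that of a multiple of u by a power of f, and the same K
    works. *)
Lemma finite_res_away m n (D0 : 'M[A]_(m, n)) :
  finite_res (@whole A) (multiple_of t) D0 ->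
  forall k (D : 'M[C]_(m, n)), iota f ^+ k *: D = map_mx iota D0 ->
    finite_res B t_multiple D.
Proof.
have scale_out p q (u : 'rV[C]_p) u0 (D : 'M[C]_(p, q)) D0' j k :
    iota f ^+ j *: u = map_mx iota u0 -> iota f ^+ k *: D = map_mx iota D0' ->
    iota f ^+ (j + k) *: (u *m D) = map_mx iota (u0 *m D0').
  by move=> eu eD; rewrite map_mxM -eu -eD -scalemxAl -scalemxAr scalerA exprD.
elim=> {m n D0} [m n D0 injD|m n l D0 K0 _ kerD _ IHK] k D eD.
  apply: finite_res_inj => u /clear_denominators[j [u0 eu]].
  case/(away_t_multiple (scale_out _ _ _ _ _ _ _ _ eu eD)) => i.
  rewrite scalemxAl => /injD h.
  apply: (t_multiple_away (k := i + j) (X0 := f ^+ i *: u0));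
    last exact/h/over_whole.
  by rewrite exprD -scalerA eu map_mxZ rmorphXn.
apply: (finite_res_step (K := map_mx iota K0)); first exact: over_map.
  move=> u uB; have [j [u0 eu]] := clear_denominators uB; split=> [|[v vB huv]].
    case/(away_t_multiple (scale_out _ _ _ _ _ _ _ _ eu eD)) => i.
    rewrite scalemxAl => /kerD[|v _ hv]; first exact: over_whole.
    have [w wB ew] := divide_pow (i + j) v f_unit; exists w => //.
    apply: (t_multiple_away (k := i + j)) hv;
      rewrite scalerBr [_ *: (w *m _)]scalemxAl ew.
    by rewrite exprD -scalerA eu map_mxB map_mxZ rmorphXn map_mxM.
  have KD : mx_in t_multiple (map_mx iota K0 *m D).
    apply: (t_multiple_away (k := k) (X0 := K0 *m D0)).
      by rewrite scalemxAr eD map_mxM.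
    move=> i i'; have : mx_in (multiple_of t) (row i K0 *m D0).
      apply/kerD; first exact: over_whole.
      exists (delta_mx 0 i); first exact: over_whole.
      by move=> i1 i2; rewrite -rowE subrr mxE; exists 0; rewrite mul0r.
    by move=> /(_ 0 i'); rewrite -row_mul mxE.
  have DB := over_away eD.
  have /mx_in_subring_multiple[Y YB eY] := KD;
    have /mx_in_subring_multiple[Z ZB eZ] := huv.
  rewrite -(subrK (v *m map_mx iota K0) u) mulmxDl -mulmxA eY eZ.
  apply/mx_in_subring_multiple; exists (Z *m D + v *m Y); last first.
    by rewrite scalerDr scalemxAl scalemxAr.
  by rewrite rpredD // mxOverM.
by apply: (IHK 0%N); rewrite scale1r.
Qed.

Lemma unit_class_adjoin_inverse :
  invertible (iota t) ->
  (forall m n (D0 : 'M[A]_(m, n)), finite_res (@whole A) (multiple_of t) D0) ->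
  (forall n (M N : 'M[C]_n), M \is a mxOver B -> N \is a mxOver B ->
    M *m N = 1%:M -> unit_class M) ->
  forall n (M N : 'M[C]_n), M \is a mxOver (away_sub (t * f)) ->
    N \is a mxOver (away_sub (t * f)) -> M *m N = 1%:M -> unit_class M.
Proof.
move=> t_unit ffrt uB n M N.
have scaled (X : 'M[C]_n) : X \is a mxOver (away_sub (t * f)) ->
    exists k, iota t ^+ k *: X \is a mxOver B.
  move=> /clear_denominators[k [X0 e]]; exists k;
    apply: (@over_away _ k _ _ _ X0).
  by rewrite scalerA -exprMn_comm -?rmorphM; [rewrite mulrC | apply: mulrC].
move=> /scaled[k MB] /scaled[l NB] MN.
apply: (unit_class_away uB _ t_unit kernel_away _ MB NB MN).
  by apply/asboolP; exists 0%N, t; rewrite mul1r.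
move=> p q E /clear_denominators[j [E0 e]].
exact: finite_res_away (ffrt _ _ E0) _ _ e.
Qed.

End OneDenominator.
End Subrings.

Theorem corollary2p4 (A : comPzRingType) (n : nat) (t : 'I_n -> A)
    (hA : regular_local A)
    (ht : forall i, t i != 0)
    (hreg : forall i, regular_ring (quot_by (t i))) :
  group_isomorphism (@det_K1 (loc_away (\prod_(i < n) t i))).
Proof.
have [A1 integral _] := regular_local_finite_res hA.
have [noethA [M [localA _]]] := hA.
have pM := prime_set_of (local_prime noethA localA); have [iM M1 _] := pM.
set T := \prod_(i < n) t i.
have T0 k : T ^+ k <> 0.
  elim: k => [|k IHk]; first exact: A1.
  rewrite exprS => /integral[|//]; rewrite /T.
  elim/big_ind: _ => // [x y hx hy /integral[]//|i _].
  exact/eqP/ht.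
pose C := localization (powers T).
pose iota : {rmorphism A -> C} := @to_loc _ (powers T).
have iota_inj : injective iota.
  move=> a b /eqP;
    rewrite -subr_eq0 -rmorphB => /eqP/to_loc_eq0[_ /asboolP[k ->]].
  by case/integral => [/T0|/eqP]; rewrite // subr_eq0 => /eqP.
have T_unit : invertible (iota T) by apply: to_loc_unit; apply/asboolP;
  exists 1%N.
have T_all (c : C) : c \in away_sub iota T.
  elim/fracW: c => a s; apply/asboolP; have /asboolP[k ek] := valP s.
  by exists k, a; rewrite -rmorphXn -ek; apply: to_loc_frac.
have factor_unit (a b : C) : invertible (a * b) -> invertible b.
  move=> /asboolP[c [_ e]]; apply/asboolP; exists (c * a).
  by split; rewrite -e; ring.
have t_unit i : invertible (iota (t i)).
  apply: (factor_unit (iota (\prod_(j < n | j != i) t j)));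
    rewrite -rmorphM mulrC.
  by suff <- : T = t i * \prod_(j < n | j != i) t j by []; apply: (bigD1 i).
have local_add (a b : A) : invertible (a + b) -> invertible a \/ invertible b.
  move=> /asboolP[c [e _]].
  have [aM|/(local_unit noethA localA)] := boolP (a \in M); last by left.
  right; apply: (local_unit noethA localA); apply/negP => bM; apply: M1.
  by rewrite -e; exact: (ideal_setM c iM (ideal_setD iM aM bM)).
suff uC (s : seq 'I_n) m (X Y : 'M[C]_m) :
    X \is a mxOver (away_sub iota (\prod_(i <- s) t i)) ->
    Y \is a mxOver (away_sub iota (\prod_(i <- s) t i)) ->
    X *m Y = 1%:M -> unit_class X.
  apply: det_K1_iso => m X /invertible_mxP[Y [_ XY]].
  by apply: (uC (index_enum 'I_n) m X Y) XY; apply/mxOverP => i j; apply: T_all.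
elim: s m X Y => [|i s IHs] m X Y.
  rewrite big_nil => /clear_denominators[k [X0 eX]].
  move=> /clear_denominators[l [Y0 eY]] XY.
  move: eX eY; rewrite rmorph1 !expr1n !scale1r => eX eY.
  rewrite eX. apply: (local_unit_class iota local_add).
  have XY0 : X0 *m Y0 = 1%:M.
    by apply: (map_mx_iota_inj iota_inj); rewrite map_mxM -eX -eY XY map_mx1.
  by apply/invertible_mxP; exists Y0; rewrite XY0 (mulmx1C XY0).
rewrite big_cons;
  apply: (unit_class_adjoin_inverse iota_inj noethA _ T_unit T_all) => //.
  elim/big_ind: _ => // [|x y hx hy]; first by rewrite rmorph1 invertible1.
  by rewrite rmorphM; apply: (invertibleM (Units hx) (Units hy)).
by move=> p q D0; apply: (finite_res_regular_quotient noethA localA).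
Qed.
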